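(* Let $p$ be a prime, let $S$ be a finite $p$-group, and let $\mathcal F$ be a saturated fusion system on $S$. If $$0\to M_1\to M_2\to M_3\to 0$$ is a short exact sequence of biset functors (respectively, of global Mackey functors) defined on $S$, then the induced sequence $$0\to M_1(\mathcal F)_{(p)}\to M_2(\mathcal F)_{(p)}\to M_3(\mathcal F)_{(p)}\to 0$$ is exact.
   Context: A fusion system $\mathcal F$ on a finite $p$-group $S$ is a category whose objects are the subgroups of $S$ and whose morphism sets $\mathcal F(P,Q)$ satisfy: $\mathrm{Hom}_S(P,Q)\subseteq \mathcal F(P,Q)\subseteq \mathrm{Inj}(P,Q)$, where $\mathrm{Inj}(P,Q)$ is the set of injective group homomorphisms and $\mathrm{Hom}_S(P,Q)$ the set of homomorphisms induced by conjugation by elements of $S$; and every $\varphi\in\mathcal F(P,Q)$ factors in $\mathcal F$ as $P\xrightarrow{\varphi}\varphi P\hookrightarrow Q$ with $\varphi^{-1}\colon\varphi P\to P$ also in $\mathcal F$. Subgroups (or elements) are $\mathcal F$-conjugate if connected by an isomorphism in $\mathcal F$. $P\le S$ is fully $\mathcal F$-centralized (resp. fully $\mathcal F$-normalized) if $|C_S(P)|\ge|C_S(P')|$ (resp. $|N_S(P)|\ge|N_S(P')|$) for all $P'$ $\mathcal F$-conjugate to $P$. $\mathcal F$ is saturated if: (1) every fully $\mathcal F$-normalized $P$ is fully $\mathcal F$-centralized and $\mathrm{Aut}_S(P)$ is a Sylow $p$-subgroup of $\mathrm{Aut}_{\mathcal F}(P)$; (2) if $\varphi\in\mathcal F(P,S)$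 has fully $\mathcal F$-centralized image, then $\varphi$ extends to some $\tilde\varphi\in\mathcal F(N_\varphi,S)$, where $N_\varphi=\{x\in N_S(P)\mid \exists y\in N_S(\varphi P)\colon \varphi\circ c_x=c_y\circ\varphi\}$. For finite groups $P,Q$, a $(P,Q)$-biset is a finite set with commuting left $P$-action and right $Q$-action; $A(P,Q)$ is the Grothendieck group of isomorphism classes of $(P,Q)$-bisets under disjoint union. Let $\mathcal A$ be the category whose objects are finite groups, with $\mathrm{Hom}_{\mathcal A}(P,Q)=A(P,Q)$ and composition $Y\circ X=X\times_Q Y$ for $X\in A(P,Q)$, $Y\in A(Q,R)$, extended bilinearly. Let $\mathcal C$ be a collection of finite groups closed under subgroups and quotients. A biset functor on $\mathcal C$ is an additive contravariant functor from the full subcategory of $\mathcal A$ on $\mathcal C$ to abelian groups; a global Mackey functor on $\mathcal C$ is an additive contravariant functor to abelian groups from the category with objects $\mathcal C$ and morphisms the subgroups $A^{\mathrm{bifree}}(P,Q)\subseteq A(P,Q)$ generated by bisets on which both actions are free. ''Defined on $S$'' means defined on some such $\mathcal C$ containing $S$. For $R\le P$ and a homomorphism $\varphi\colon R\to Q$, let $[R,\varphi]_P^Q$ be the $(P,Q)$-biset $(P\times Q)/\big((xr,q)\sim(x,\varphi(r)q)\big)$, $r\in R$. For an injective $\varphi\colon P\to S$, $\mathrm{res}_\varphi\colon M(S)\to M(P)$ is the map induced by $[P,\varphi]_P^S$; $\mathrm{res}_P$ is the case where $\varphi$ is the inclusion. Define $$M(\mathcal F)=\{X\in M(S)\mid \mathrm{res}_\varphi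 X=\mathrm{res}_P X\text{ for all }P\le S,\ \varphi\in\mathcal F(P,S)\}.$$ The subscript $(p)$ denotes localization at $p$, i.e. tensoring with $\mathbb Z_{(p)}$. Short exactness of functors means exactness at every group of $\mathcal C$, the maps being natural transformations. *)

(* Defs.v *)
From HB Require Import structures.
From mathcomp Require Import all_boot all_order all_algebra.
From mathcomp Require Import all_fingroup all_solvable.
From mathcomp.classical Require Import boolp.

Set Implicit Arguments.
Unset Strict Implicit.
Unset Printing Implicit Defensive.

Import generic_quotient GRing.Theory.
Local Open Scope ring_scope.
Local Open Scope quotient_scope.

Section Subgroup.
Variables (V : zmodType) (H : zmodClosed V).

Record subz := Subz { subz_val : V; _ : subz_val \in H }.

HB.instance Definition _ := [isSub for subz_val].
HB.instance Definition _ := [Choice of subz by <:].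
HB.instance Definition _ := [SubChoice_isSubZmodule of subz by <:].

End Subgroup.

Definition zspan (V : zmodType) (G : V -> Prop) : {pred V} := fun v =>
  `[< forall H : zmodClosed V, (forall u, G u -> u \in H) -> v \in H >].

Section Span.
Variables (V : zmodType) (G : V -> Prop).

Lemma zspan_closed : zmod_closed (zspan G).
Proof.
split=> [|u v /asboolP Hu /asboolP Hv].
  by apply/asboolP=> H _; apply: rpred0.
by apply/asboolP=> H HG; rewrite rpredB ?Hu ?Hv.
Qed.
HB.instance Definition _ := GRing.isZmodClosed.Build V (zspan G) zspan_closed.

Lemma mem_zspan v : G v -> v \in zspan G.
Proof. by move=> Gv; apply/asboolP=> H; apply. Qed.

Lemma zspan_ind (T : V -> Prop) : T 0 -> (forall u v, T u -> T v -> T (u - v)) ->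
  (forall v, G v -> T v) -> forall v, v \in zspan G -> T v.
Proof.
move=> T0 TB TG v /asboolP Hv.
have cT : zmod_closed (fun v => `[< T v >]).
  split=> [|a b /asboolP Ta /asboolP Tb]; first exact/asboolP.
  exact/asboolP/TB.
pose mT := GRing.isZmodClosed.Build V (fun v => `[< T v >]) cT.
pose H : zmodClosed V := HB.pack (fun v : V => `[< T v >]) mT.
by apply/asboolP; apply: (Hv H) => u Gu; apply/asboolP/TG.
Qed.

End Span.

Section Grothendieck.
Variable N : nmodType.
Implicit Types u v : N * N.

Definition groth_eq u v := `[< exists z, u.1 + v.2 + z = v.1 + u.2 + z >].

Lemma groth_eq_equiv : equiv_class_of groth_eq.
Proof.
split=> [u|u v|v u w].
- by apply/asboolP; exists 0.
- by apply/asboolP/asboolP=> -[z ez]; exists z.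
move=> /asboolP[z ez] /asboolP[t et]; apply/asboolP.
exists (v.1 + v.2 + z + t).
rewrite [LHS](AC (2*4) ((1*4*5)*(3*2*6)))%AC /= ez et.
by rewrite [LHS](AC (3*3) ((4*2)*(1*5*3*6)))%AC.
Qed.
Canonical groth_equiv := EquivRelPack groth_eq_equiv.

Definition groth := {eq_quot groth_eq}.
HB.instance Definition _ := Choice.on groth.
HB.instance Definition _ := EqQuotient.on groth.

Lemma groth_eqP u v :
  reflect (\pi_groth u = \pi_groth v) (groth_eq u v).
Proof. exact: eqmodP. Qed.

Definition groth_add (x y : groth) : groth :=
  \pi_groth ((repr x).1 + (repr y).1, (repr x).2 + (repr y).2).
Definition groth_opp (x : groth) : groth := \pi_groth ((repr x).2, (repr x).1).

Lemma groth_repr u : exists z,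
  u.1 + (repr (\pi_groth u)).2 + z = (repr (\pi_groth u)).1 + u.2 + z.
Proof.
have /groth_eqP/asboolP[z ez] : \pi_groth u = \pi_groth (repr (\pi_groth u)).
  by rewrite reprK.
by exists z.
Qed.

Lemma groth_addE u v : groth_add (\pi u) (\pi v) = \pi_groth (u.1 + v.1, u.2 + v.2).
Proof.
have [z ez] := groth_repr u; have [t et] := groth_repr v.
apply/groth_eqP/asboolP; exists (z + t) => /=; symmetry.
rewrite [LHS](AC (2*2*2) ((1*3*5)*(2*4*6)))%AC /= ez et.
by rewrite [LHS](AC (3*3) ((1*4)*(2*5)*(3*6)))%AC.
Qed.

Lemma groth_oppE u : groth_opp (\pi u) = \pi_groth (u.2, u.1).
Proof.
have [z ez] := groth_repr u.
apply/groth_eqP/asboolP; exists z => /=.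
by rewrite [_ + u.1]addrC ez [u.2 + _]addrC.
Qed.

Lemma groth_addA : associative groth_add.
Proof.
elim/quotW=> u; elim/quotW=> v; elim/quotW=> w.
by rewrite !groth_addE /= !addrA.
Qed.
Lemma groth_addC : commutative groth_add.
Proof.
by elim/quotW=> u; elim/quotW=> v; rewrite !groth_addE addrC (addrC u.2).
Qed.
Lemma groth_add0 : left_id (\pi_groth (0, 0)) groth_add.
Proof. by elim/quotW=> u; rewrite groth_addE /= !add0r -surjective_pairing. Qed.
Lemma groth_addN : left_inverse (\pi_groth (0, 0)) groth_opp groth_add.
Proof.
elim/quotW=> u; rewrite groth_oppE groth_addE; apply/groth_eqP/asboolP.
by exists 0; rewrite /= !addr0 add0r addrC.
Qed.
HB.instance Definition _ := GRing.isZmodule.Build groth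
  groth_addA groth_addC groth_add0 groth_addN.

Definition groth_in (a : N) : groth := \pi_groth (a, 0).

Lemma pi_grothD u v : \pi_groth (u.1 + v.1, u.2 + v.2) = \pi_groth u + \pi_groth v.
Proof. by rewrite -groth_addE. Qed.

Lemma groth_in_is_additive : nmod_morphism groth_in.
Proof.
by split=> // a b; rewrite -(pi_grothD (a, 0) (b, 0)) /= addr0.
Qed.
HB.instance Definition _ := GRing.isNmodMorphism.Build N groth groth_in
  groth_in_is_additive.

Lemma pi_grothE u : \pi_groth u = groth_in u.1 - groth_in u.2.
Proof.
have -> : - groth_in u.2 = \pi_groth (0, u.2) by exact: groth_oppE.
by rewrite -pi_grothD /= addr0 add0r -surjective_pairing.
Qed.

Lemma groth_in_eq a b : groth_in a = groth_in b <-> exists z, a + z = b + z.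
Proof.
split=> [/groth_eqP/asboolP[z]|[z ez]]; first by rewrite /= !addr0; exists z.
by apply/groth_eqP/asboolP; exists z; rewrite /= !addr0.
Qed.

Lemma groth_ind (T : groth -> Prop) : (forall a, T (groth_in a)) ->
  (forall x y, T x -> T y -> T (x - y)) -> forall x, T x.
Proof.
by move=> Tin TB; elim/quotW=> u; rewrite pi_grothE; apply: TB.
Qed.

End Grothendieck.

Section BilinearExtension.
Variables (N1 N2 N3 : nmodType) (f : N1 -> N2 -> N3).

Definition groth_bil (x : groth N1) (y : groth N2) : groth N3 :=
  \pi_(groth N3) (f (repr x).1 (repr y).1 + f (repr x).2 (repr y).2,
                  f (repr x).1 (repr y).2 + f (repr x).2 (repr y).1).

Hypothesis fDl : forall b, nmod_morphism (f^~ b).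
Hypothesis fDr : forall a, nmod_morphism (f a).

Let fin a b := groth_in (f a b).
Let finDl a a' b : fin (a + a') b = fin a b + fin a' b.
Proof. by rewrite /fin (fDl b).2 raddfD. Qed.
Let finDr a b b' : fin a (b + b') = fin a b + fin a b'.
Proof. by rewrite /fin (fDr a).2 raddfD. Qed.

Let bil u v := fin u.1 v.1 + fin u.2 v.2 - (fin u.1 v.2 + fin u.2 v.1).

Let subE (V : zmodType) (a b c d : V) : a + b = c + d -> a - d = c - b.
Proof. by move=> e; apply/eqP; rewrite subr_eq addrAC -e addrK eqxx. Qed.

Let bilE u v : groth_eq u v -> forall w,  bil u w = bil v w.
Proof.
move=> /asboolP[z ez] w.
have H b : fin u.1 b - fin u.2 b = fin v.1 b - fin v.2 b.
  have := congr1 (fin^~ b) ez; rewrite !finDl => /addIr; exact: subE.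
have K t : bil t w = (fin t.1 w.1 - fin t.2 w.1) - (fin t.1 w.2 - fin t.2 w.2).
  by rewrite /bil !opprD !opprK [LHS](AC (2*2) (1*4*(3*2)))%AC.
by rewrite !K !H.
Qed.

Let bilE' u v : groth_eq u v -> forall w,  bil w u = bil w v.
Proof.
move=> /asboolP[z ez] w.
have H b : fin b u.1 - fin b u.2 = fin b v.1 - fin b v.2.
  have := congr1 (fin b) ez; rewrite !finDr => /addIr; exact: subE.
have K t : bil w t = (fin w.1 t.1 - fin w.1 t.2) - (fin w.2 t.1 - fin w.2 t.2).
  by rewrite /bil !opprD !opprK [LHS](AC (2*2) (1*3*(4*2)))%AC.
by rewrite !K !H.
Qed.

Let groth_bil_pi u v : groth_bil (\pi u) (\pi v) = bil u v.
Proof.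
have hu : groth_eq u (repr (\pi_(groth N1) u)) by apply/groth_eqP; rewrite reprK.
have hv : groth_eq v (repr (\pi_(groth N2) v)) by apply/groth_eqP; rewrite reprK.
by rewrite (bilE hu) (bilE' hv) /groth_bil [LHS]pi_grothE /= !raddfD /= /bil opprD.
Qed.

Lemma groth_bil_in a b : groth_bil (groth_in a) (groth_in b) = groth_in (f a b).
Proof.
by rewrite groth_bil_pi /bil /= /fin !(fDl _).1 !(fDr _).1 !raddf0 !addr0 subr0.
Qed.

Lemma groth_bilDl x x' y : groth_bil (x + x') y = groth_bil x y + groth_bil x' y.
Proof.
elim/quotW: x => u; elim/quotW: x' => u'; elim/quotW: y => v.
rewrite -pi_grothD !groth_bil_pi /bil /= !finDl !opprD.
by rewrite [LHS](AC ((2*2)*(2*2)) ((1*3*(5*7))*(2*4*(6*8))))%AC.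
Qed.

Lemma groth_bilDr x y y' : groth_bil x (y + y') = groth_bil x y + groth_bil x y'.
Proof.
elim/quotW: x => u; elim/quotW: y => v; elim/quotW: y' => v'.
rewrite -pi_grothD !groth_bil_pi /bil /= !finDr !opprD.
by rewrite [LHS](AC ((2*2)*(2*2)) ((1*3*(5*7))*(2*4*(6*8))))%AC.
Qed.

End BilinearExtension.

(** Localization at [p] as a group of fractions; denominators are the
    natural numbers prime to [p], i.e. for [p] prime the positive elements of
    [Z \ (p)]. *)

Section Localization.
Variables (p : nat) (V : zmodType).

Definition denom := {n : nat | coprime p n}.
Implicit Types u v : V * denom.

Definition denom1 : denom := exist (fun k => coprime p k) 1%N (coprimen1 p).
Lemma denomM_subproof (m n : denom) : coprime p (val m * val n).
Proof. by rewrite coprimeMr (valP m) (valP n). Qed.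
Definition denomM (m n : denom) : denom := exist (fun k => coprime p k) (val m * val n)%N (denomM_subproof m n).

Definition loc_eq u v :=
  `[< exists k : denom,
        u.1 *+ (val k * val v.2) = v.1 *+ (val k * val u.2) >].

Lemma loc_eq_equiv : equiv_class_of loc_eq.
Proof.
split=> [u|u v|v u w].
- by apply/asboolP; exists denom1.
- by apply/asboolP/asboolP=> -[k ek]; exists k.
move=> /asboolP[k ek] /asboolP[l el]; apply/asboolP.
exists (denomM (denomM k l) v.2) => /=.
have -> : (val k * val l * val v.2 * val w.2 = val k * val v.2 * (val l * val w.2))%N.
  by rewrite [LHS](AC 4 ((1*3)*(2*4)))%AC.
rewrite mulrnA ek -mulrnA.
have -> : (val k * val u.2 * (val l * val w.2) = val l * val w.2 * (val k * val u.2))%N.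
  by rewrite mulnC.
rewrite mulrnA el -mulrnA; congr (_ *+ _).
by rewrite [LHS](AC (2*2) ((3*1*2)*4))%AC.
Qed.
Canonical loc_equiv := EquivRelPack loc_eq_equiv.

Definition loc := {eq_quot loc_eq}.
HB.instance Definition _ := Choice.on loc.
HB.instance Definition _ := EqQuotient.on loc.

Definition frac (x : V) (n : denom) : loc := \pi_loc (x, n).

Lemma fracP x m y n : frac x m = frac y n <->
  exists k : denom, x *+ (val k * val n) = y *+ (val k * val m).
Proof.
by split=> [/eqmodP/asboolP|H]; last apply/eqmodP/asboolP.
Qed.

Lemma locW (T : loc -> Prop) : (forall x n, T (frac x n)) -> forall a, T a.
Proof. by move=> H; elim/quotW=> -[]. Qed.

Definition loc_add (a b : loc) : loc :=
  frac ((repr a).1 *+ val (repr b).2 + (repr b).1 *+ val (repr a).2)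
       (denomM (repr a).2 (repr b).2).
Definition loc_opp (a : loc) : loc := frac (- (repr a).1) (repr a).2.

Lemma loc_repr x n : exists k : denom, (repr (frac x n)).1 *+ (val k * val n)
  = x *+ (val k * val (repr (frac x n)).2).
Proof.
by apply/fracP; rewrite /frac -surjective_pairing reprK.
Qed.

Lemma loc_addE x m y n : loc_add (frac x m) (frac y n) =
  frac (x *+ val n + y *+ val m) (denomM m n).
Proof.
have [k ek] := loc_repr x m; have [l el] := loc_repr y n.
set a := repr _ in ek *; set b := repr _ in el *.
apply/fracP; exists (denomM k l); rewrite !mulrnDl -!mulrnA /=; congr (_ + _).
  have -> : (val b.2 * (val k * val l * (val m * val n)) =
             val k * val m * (val b.2 * val l * val n))%N.
    by rewrite [LHS](AC (1*(2*2)) (2*4*(1*3*5)))%AC.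
  rewrite mulrnA ek -mulrnA; congr (_ *+ _).
  by rewrite [LHS](AC (2*3) (5*((1*4)*(2*3))))%AC.
have -> : (val a.2 * (val k * val l * (val m * val n)) =
           val l * val n * (val a.2 * val k * val m))%N.
  by rewrite [LHS](AC (1*(2*2)) (3*5*(1*2*4)))%AC.
rewrite mulrnA el -mulrnA; congr (_ *+ _).
by rewrite [LHS](AC (2*3) (5*((4*1)*(3*2))))%AC.
Qed.

Lemma loc_oppE x m : loc_opp (frac x m) = frac (- x) m.
Proof.
have [k ek] := loc_repr x m.
by apply/fracP; exists k; rewrite !mulNrn ek.
Qed.

Lemma loc_addA : associative loc_add.
Proof.
elim/locW=> x m; elim/locW=> y n; elim/locW=> z k.
rewrite !loc_addE; apply/fracP; exists denom1; rewrite /= !mul1n.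
rewrite (mulnA (val m)); congr (_ *+ _).
rewrite !mulrnDl -!mulrnA addrA; congr (_ + _ + _); congr (_ *+ _); exact: mulnC.
Qed.
Lemma loc_addC : commutative loc_add.
Proof.
elim/locW=> x m; elim/locW=> y n; rewrite !loc_addE addrC.
by apply/fracP; exists denom1; rewrite /= (mulnC (val m)).
Qed.
Lemma loc_add0 : left_id (frac 0 denom1) loc_add.
Proof.
elim/locW=> x m; rewrite !loc_addE mul0rn add0r mulr1n.
by apply/fracP; exists denom1; rewrite /= !mul1n.
Qed.
Lemma loc_addN : left_inverse (frac 0 denom1) loc_opp loc_add.
Proof.
elim/locW=> x m; rewrite loc_oppE loc_addE mulNrn addNr.
by apply/fracP; exists denom1; rewrite !mul0rn.
Qed.
HB.instance Definition _ := GRing.isZmodule.Build loc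
  loc_addA loc_addC loc_add0 loc_addN.

Lemma fracD x m y n : frac x m + frac y n = frac (x *+ val n + y *+ val m) (denomM m n).
Proof. exact: loc_addE. Qed.

End Localization.

Section LocalizedMap.
Variables (p : nat) (U V : zmodType) (f : {additive U -> V}).

Definition loc_map (a : loc p U) : loc p V := frac (f (repr a).1) (repr a).2.

Lemma loc_mapE x n : loc_map (frac x n) = frac (f x) n.
Proof.
have [k ek] := loc_repr x n.
by apply/fracP; exists k; rewrite -!raddfMn ek.
Qed.

Lemma loc_map_is_additive : nmod_morphism loc_map.
Proof.
split; first by rewrite -[0](erefl (frac 0 _)) loc_mapE raddf0.
elim/locW=> x m; elim/locW=> y n.
by rewrite fracD !loc_mapE fracD raddfD !raddfMn.
Qed.
HB.instance Definition _ := GRing.isNmodMorphism.Build (loc p U) (loc p V) loc_map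
  loc_map_is_additive.

End LocalizedMap.

Arguments loc_map p {U V} f _.

Definition short_exact (U V W : zmodType) (f : {additive U -> V})
    (g : {additive V -> W}) : Prop :=
  [/\ injective f,
      forall v, g v = 0 <-> exists u, f u = v
    & forall w, exists v, g v = w].

Record biset_on (P Q : finGroupType) (X : finType) := BisetOn {
  lact : P -> X -> X;
  ract : X -> Q -> X;
  lact1 : forall x, lact 1%g x = x;
  lactM : forall g h x, lact (g * h)%g x = lact g (lact h x);
  ract1 : forall x, ract x 1%g = x;
  ractM : forall x g h, ract x (g * h)%g = ract (ract x g) h;
  lractA : forall g x h, lact g (ract x h) = ract (lact g x) h }.

Record biset (P Q : finGroupType) :=
  Biset { bset :> finType; bact : biset_on P Q bset }.

Notation bl := (lact (bact _)).
Notation br := (ract (bact _)).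

Definition biset_iso (P Q : finGroupType) (X Y : biset P Q) : Prop :=
  exists f : X -> Y,
    [/\ bijective f, forall g x, f (bl g x) = bl g (f x)
      & forall x h, f (br x h) = br (f x) h].

Section BisetBasics.
Variables P Q : finGroupType.
Implicit Types X Y Z : biset P Q.

Lemma biso_refl X : biset_iso X X.
Proof. by exists id; split=> //; exists id. Qed.
Lemma biso_sym X Y : biset_iso X Y -> biset_iso Y X.
Proof.
move=> [f [[f' fK f'K] fl fr]]; exists f'; split; first by exists f.
  by move=> g y; rewrite -{1}[y]f'K -fl fK.
by move=> y h; rewrite -{1}[y]f'K -fr fK.
Qed.
Lemma biso_trans X Y Z : biset_iso X Y -> biset_iso Y Z -> biset_iso X Z.
Proof.
move=> [f [bf fl fr]] [g [bg gl gr]]; exists (g \o f); split.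
- exact: bij_comp.
- by move=> a x /=; rewrite fl gl.
by move=> x a /=; rewrite fr gr.
Qed.

Section Sum.
Variables X Y : biset P Q.
Definition sum_lact g (z : X + Y) : X + Y :=
  match z with inl x => inl (bl g x) | inr y => inr (bl g y) end.
Definition sum_ract (z : X + Y) h : X + Y :=
  match z with inl x => inl (br x h) | inr y => inr (br y h) end.
Definition biset_sum : biset P Q.
Proof.
exists (X + Y)%type; exists sum_lact sum_ract.
- by case=> x /=; rewrite lact1.
- by move=> g h [] x /=; rewrite lactM.
- by case=> x /=; rewrite ract1.
- by case=> x g h /=; rewrite ractM.
- by move=> g [] x h /=; rewrite lractA.
Defined.
End Sum.

Definition biset0 : biset P Q.
Proof.
by exists void; exists (fun _ x => x) (fun x _ => x).
Defined.

Section Transport.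
Variables (X : biset P Q) (T : finType) (f : X -> T) (f' : T -> X).
Hypotheses (fK : cancel f f') (f'K : cancel f' f).
Definition transport : biset_on P Q T.
Proof.
exists (fun g t => f (bl g (f' t))) (fun t h => f (br (f' t) h)).
- by move=> t; rewrite lact1 f'K.
- by move=> g h t; rewrite lactM fK.
- by move=> t; rewrite ract1 f'K.
- by move=> t g h; rewrite ractM fK.
- by move=> g t h; rewrite !fK lractA.
Defined.
Lemma transport_iso : biset_iso X (Biset transport).
Proof.
exists f; split; first by exists f'.
  by move=> g x /=; rewrite fK.
by move=> x h /=; rewrite fK.
Qed.
End Transport.

(** Isomorphism classes are formed on bisets carried by ordinals: up to
    isomorphism these are all the bisets, and they form a small type. *)

Definition ord_biset := {classic {n : nat & biset_on P Q 'I_n}}.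
Definition of_ord (s : ord_biset) : biset P Q := Biset (projT2 s).
Definition to_ord X : ord_biset :=
  existT (fun n => biset_on P Q 'I_n) #|X| (transport (@enum_rankK X) (@enum_valK X)).
Lemma to_ordP X : biset_iso X (of_ord (to_ord X)).
Proof. exact: transport_iso. Qed.

Definition ord_iso (s t : ord_biset) := `[< biset_iso (of_ord s) (of_ord t) >].
Lemma ord_iso_equiv : equiv_class_of ord_iso.
Proof.
split=> [s|s t|t s u]; first exact/asboolP/biso_refl.
  by apply/asboolP/asboolP=> /biso_sym.
by move=> /asboolP st /asboolP tu; apply/asboolP/(biso_trans st).
Qed.
Canonical ord_iso_equivrel := EquivRelPack ord_iso_equiv.

Definition biset_class := {eq_quot ord_iso}.
HB.instance Definition _ := Choice.on biset_class.
HB.instance Definition _ := EqQuotient.on biset_class.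

Definition bclass X : biset_class := \pi_biset_class (to_ord X).
Definition brepr (c : biset_class) : biset P Q := of_ord (repr c).

Lemma bclassP X Y : bclass X = bclass Y <-> biset_iso X Y.
Proof.
split=> [/eqmodP/asboolP|] H.
  by apply: biso_trans (to_ordP X) (biso_trans H (biso_sym (to_ordP Y))).
apply/eqmodP/asboolP.
exact: biso_trans (biso_sym (to_ordP X)) (biso_trans H (to_ordP Y)).
Qed.
Lemma breprK c : bclass (brepr c) = c.
Proof.
rewrite -[RHS]reprK; apply/eqmodP/asboolP; exact: biso_sym (to_ordP _).
Qed.
Lemma bclassW (T : biset_class -> Prop) : (forall X, T (bclass X)) -> forall c, T c.
Proof. by move=> H c; rewrite -[c]breprK. Qed.
Lemma bclassK X : biset_iso (brepr (bclass X)) X.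
Proof. by apply/bclassP; rewrite breprK. Qed.

Definition bclass_add (c d : biset_class) : biset_class :=
  bclass (biset_sum (brepr c) (brepr d)).

Lemma sum_iso X X' Y Y' : biset_iso X X' -> biset_iso Y Y' ->
  biset_iso (biset_sum X Y) (biset_sum X' Y').
Proof.
move=> [f [[f' fK f'K] fl fr]] [g [[g' gK g'K] gl gr]].

exists (fun z : X + Y => match z with inl x => inl (f x) | inr y => inr (g y) end).
split=> [|a []x|[]x a] /=; rewrite ?fl ?fr ?gl ?gr //.
exists (fun z : X' + Y' => match z with inl x => inl (f' x) | inr y => inr (g' y) end).
  by case=> x; rewrite ?fK ?gK.
by case=> x; rewrite ?f'K ?g'K.
Qed.

Lemma bclass_addE X Y : bclass_add (bclass X) (bclass Y) = bclass (biset_sum X Y).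
Proof. exact/bclassP/sum_iso/bclassK/bclassK. Qed.

Lemma bclass_addA : associative bclass_add.
Proof.
elim/bclassW=> X; elim/bclassW=> Y; elim/bclassW=> Z; rewrite !bclass_addE.
apply/bclassP.
exists (fun z : X + (Y + Z) => match z with inl x => inl (inl x)
   | inr (inl y) => inl (inr y) | inr (inr z) => inr z end).
split=> [|a [x|[x|x]]|[x|[x|x]] a] //=.
by exists (fun z : X + Y + Z => match z with inr x => inr (inr x)
   | inl (inr y) => inr (inl y) | inl (inl z) => inl z end) => [[x|[x|x]]|[[x|x]|x]].
Qed.
Lemma bclass_addC : commutative bclass_add.
Proof.
elim/bclassW=> X; elim/bclassW=> Y; rewrite !bclass_addE.
apply/bclassP.
exists (fun z : X + Y => match z with inl x => inr x | inr y => inl y end).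
split=> [|a [x|x]|[x|x] a] //=.
by exists (fun z : Y + X => match z with inl x => inr x | inr y => inl y end) => [[x|x]|[x|x]].
Qed.
Lemma bclass_add0 : left_id (bclass biset0) bclass_add.
Proof.
elim/bclassW=> X; rewrite bclass_addE; apply/bclassP.

exists (fun z : void + X => match z with inl x => of_void X x | inr y => y end).
split=> [|a [[]|x]|[[]|x] a] //=.
by exists (fun x => inr x) => [[[]|x]|x].
Qed.
HB.instance Definition _ := GRing.isNmodule.Build biset_class
  bclass_addA bclass_addC bclass_add0.

Lemma bclassD X Y : bclass (biset_sum X Y) = bclass X + bclass Y.
Proof. by rewrite -bclass_addE. Qed.

End BisetBasics.

(** [A(P, Q)] *)
Definition burnside (P Q : finGroupType) := groth (biset_class P Q).
HB.instance Definition _ P Q := GRing.Zmodule.on (burnside P Q).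

Definition bcls (P Q : finGroupType) (X : biset P Q) : burnside P Q :=
  groth_in (bclass X).

Section Tensor.
Variables (P Q R : finGroupType) (X : biset P Q) (Y : biset Q R).

(** [(x q, y) ~ (x, q y)] for [q : Q] is already an equivalence relation. *)
Definition tens_eq (u v : X * Y) : bool :=
  [exists q : Q, (u.1 == br v.1 q) && (v.2 == bl q u.2)].

Lemma tens_eqP x y x' y' :
  reflect (exists2 q : Q, x = br x' q & y' = bl q y) (tens_eq (x, y) (x', y')).
Proof.
apply: (iffP existsP) => -[q]; first by case/andP=> /= /eqP-> /eqP->; exists q.
by move=> -> ->; exists q; rewrite /= !eqxx.
Qed.

Lemma tens_eq_equiv : equiv_class_of tens_eq.
Proof.
split.
- by move=> [x y]; apply/tens_eqP; exists 1%g; rewrite ?ract1 ?lact1.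
- apply: symmetric_from_pre => -[x y] [x' y'] /tens_eqP[q -> ->].
  by apply/tens_eqP; exists q^-1%g; rewrite -?ractM -?lactM ?mulgV ?mulVg ?ract1 ?lact1.
move=> [x2 y2] [x1 y1] [x3 y3] /tens_eqP[q -> ->] /tens_eqP[r -> ->].
by apply/tens_eqP; exists (r * q)%g; rewrite ?ractM ?lactM.
Qed.
Canonical tens_equiv := EquivRelPack tens_eq_equiv.

Definition tens := {eq_quot tens_eq}.
HB.instance Definition _ := EqQuotient.on tens.
HB.instance Definition _ := Choice.on tens.
HB.instance Definition _ := Countable.copy tens (can_type (@reprK _ tens)).
HB.instance Definition _ := isFinite.Build tens (pcan_enumP (can_pcan (@reprK _ tens))).

Definition tpair (x : X) (y : Y) : tens := \pi_tens (x, y).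

Lemma tpairP x y x' y' :
  tpair x y = tpair x' y' <-> exists2 q : Q, x = br x' q & y' = bl q y.
Proof. by split=> [/eqmodP/tens_eqP | H]; last apply/eqmodP/tens_eqP. Qed.
Lemma tpairA x q y : tpair (br x q) y = tpair x (bl q y).
Proof. by apply/tpairP; exists q. Qed.
Lemma tensW (T : tens -> Prop) : (forall x y, T (tpair x y)) -> forall z, T z.
Proof. by move=> H; elim/quotW=> -[]. Qed.

Definition tens_lact (g : P) (z : tens) : tens := tpair (bl g (repr z).1) (repr z).2.
Definition tens_ract (z : tens) (h : R) : tens := tpair (repr z).1 (br (repr z).2 h).

Lemma tens_repr x y : exists2 q : Q,
  x = br (repr (tpair x y)).1 q & (repr (tpair x y)).2 = bl q y.
Proof. by apply/tpairP; rewrite /tpair -surjective_pairing reprK. Qed.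

Lemma tens_lactE g x y : tens_lact g (tpair x y) = tpair (bl g x) y.
Proof.
have [q e1 e2] := tens_repr x y.
by rewrite {2}e1 /tens_lact e2 lractA tpairA.
Qed.
Lemma tens_ractE x y h : tens_ract (tpair x y) h = tpair x (br y h).
Proof.
have [q e1 e2] := tens_repr x y.
by rewrite {2}e1 /tens_ract e2 -lractA tpairA.
Qed.

Definition biset_tens : biset P R.
Proof.
exists tens; exists tens_lact tens_ract.
- by elim/tensW=> x y; rewrite tens_lactE lact1.
- by move=> g h; elim/tensW=> x y; rewrite !tens_lactE lactM.
- by elim/tensW=> x y; rewrite tens_ractE ract1.
- by elim/tensW=> x y g h; rewrite !tens_ractE ractM.
- by move=> g; elim/tensW=> x y h; rewrite !(tens_ractE, tens_lactE).
Defined.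

Lemma bl_tpair g x y : bl g (tpair x y : biset_tens) = tpair (bl g x) y.
Proof. exact: tens_lactE. Qed.
Lemma br_tpair x y h : br (tpair x y : biset_tens) h = tpair x (br y h).
Proof. exact: tens_ractE. Qed.

Lemma tens_lift (T : Type) (f : X -> Y -> T) :
  (forall x q y, f (br x q) y = f x (bl q y)) ->
  exists F : biset_tens -> T, forall x y, F (tpair x y) = f x y.
Proof.
move=> fA; exists (fun z => f (repr z).1 (repr z).2) => x y.
by have [q e1 e2] := tens_repr x y; rewrite e2 -fA -e1.
Qed.

End Tensor.

Lemma eq_tens (P Q R : finGroupType) (X : biset P Q) (Y : biset Q R) (T : Type)
    (f g : biset_tens X Y -> T) :
  (forall x y, f (tpair x y) = g (tpair x y)) -> f =1 g.
Proof. by move=> H; elim/tensW. Qed.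

Lemma tens_iso (P Q R : finGroupType) (X X' : biset P Q) (Y Y' : biset Q R) :
  biset_iso X X' -> biset_iso Y Y' -> biset_iso (biset_tens X Y) (biset_tens X' Y').
Proof.
move=> [f [[f' fK f'K] fl fr]] [g [[g' gK g'K] gl gr]].
have f'r x q : f' (br x q) = br (f' x) q by rewrite -{1}[x]f'K -fr fK.
have g'l q y : g' (bl q y) = bl q (g' y) by rewrite -{1}[y]g'K -gl gK.
have [|F FE] := @tens_lift _ _ _ X Y (biset_tens X' Y') (fun x y => tpair (f x) (g y)).
  by move=> x q y; rewrite fr gl tpairA.
have [|F' FE'] := @tens_lift _ _ _ X' Y' (biset_tens X Y) (fun x y => tpair (f' x) (g' y)).
  by move=> x q y; rewrite f'r g'l tpairA.
exists F; split.
- by exists F'; apply: eq_tens => x y; rewrite /= ?FE ?FE' ?FE ?fK ?gK ?f'K ?g'K.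
- by move=> a; elim/tensW=> x y; rewrite bl_tpair !FE bl_tpair fl.
by elim/tensW=> x y a; rewrite br_tpair !FE br_tpair gr.
Qed.

Lemma tensA_iso (P Q R S : finGroupType)
    (X : biset P Q) (Y : biset Q R) (Z : biset R S) :
  biset_iso (biset_tens X (biset_tens Y Z)) (biset_tens (biset_tens X Y) Z).
Proof.
pose XY := biset_tens X Y; pose YZ := biset_tens Y Z.
have hf x : exists F : YZ -> biset_tens XY Z,
    forall y z, F (tpair y z) = tpair (tpair x y : XY) z.
  by apply: tens_lift => y r z; rewrite -tpairA br_tpair.
have [f fE] := choice hf.
have hg z : exists G : XY -> biset_tens X YZ,
    forall x y, G (tpair x y) = tpair x (tpair y z : YZ).
  by apply: tens_lift => x q y; rewrite tpairA bl_tpair.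
have [g gE] := choice hg.
have [|F FE] := @tens_lift _ _ _ X YZ _ f.
  by move=> x q; elim/tensW=> y z; rewrite bl_tpair !fE tpairA.
have [|G GE] := @tens_lift _ _ _ XY Z _ (fun u z => g z u).
  by elim/tensW=> x y r z; rewrite br_tpair !gE tpairA.
exists F; split.
- exists G.
    by elim/tensW=> x; elim/tensW=> y z; rewrite FE fE GE gE.
  by elim/tensW; elim/tensW=> x y z; rewrite GE gE FE fE.
- by move=> a; elim/tensW=> x; elim/tensW=> y z; rewrite bl_tpair !FE !fE !bl_tpair.
by elim/tensW=> x; elim/tensW=> y z a; rewrite br_tpair !FE br_tpair !fE !br_tpair.
Qed.

Definition biset1 (P : finGroupType) : biset P P.
Proof.
exists P; exists (fun g x => g * x)%g (fun x h => x * h)%g.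
- exact: mul1g.
- by move=> g h x; rewrite mulgA.
- exact: mulg1.
- by move=> x g h; rewrite mulgA.
- by move=> g x h; rewrite mulgA.
Defined.

Section TensorLaws.
Variables P Q R : finGroupType.
Implicit Types (X : biset P Q) (Y : biset Q R).

Lemma tens1_iso X : biset_iso (biset_tens (biset1 P) X) X.
Proof.
have [|F FE] := @tens_lift _ _ _ (biset1 P) X X (fun g x => bl g x).
  by move=> g h x; rewrite -lactM.
exists F; split.
- exists (fun x => tpair (1%g : biset1 P) x); last by move=> x; rewrite FE lact1.
  by elim/tensW=> g x; rewrite FE -tpairA /= mul1g.
- by move=> a; elim/tensW=> g x; rewrite bl_tpair !FE -lactM.
by elim/tensW=> g x a; rewrite br_tpair !FE lractA.
Qed.

Lemma tensr1_iso X : biset_iso (biset_tens X (biset1 Q)) X.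
Proof.
have [|F FE] := @tens_lift _ _ _ X (biset1 Q) X (fun x g => br x g).
  by move=> x g h; rewrite -ractM.
exists F; split.
- exists (fun x => tpair x (1%g : biset1 Q)); last by move=> x; rewrite FE ract1.
  by elim/tensW=> x g; rewrite FE tpairA /= mulg1.
- by move=> a; elim/tensW=> x g; rewrite bl_tpair !FE lractA.
by elim/tensW=> x g a; rewrite br_tpair !FE -ractM.
Qed.

Lemma tensDl_iso X X' Y : biset_iso (biset_tens (biset_sum X X') Y)
  (biset_sum (biset_tens X Y) (biset_tens X' Y)).
Proof.
have [|F FE] := @tens_lift _ _ _ (biset_sum X X') Y
  (biset_sum (biset_tens X Y) (biset_tens X' Y))
  (fun z y => match z with inl x => inl (tpair x y) | inr x => inr (tpair x y) end).
  by move=> [] x q y /=; rewrite tpairA.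
have [|G GE] := @tens_lift _ _ _ X Y (biset_tens (biset_sum X X') Y)
  (fun x y => tpair (inl x : biset_sum X X') y).
  by move=> x q y; rewrite -tpairA.
have [|H HE] := @tens_lift _ _ _ X' Y (biset_tens (biset_sum X X') Y)
  (fun x y => tpair (inr x : biset_sum X X') y).
  by move=> x q y; rewrite -tpairA.
exists F; split.
- exists (fun z => match z with inl u => G u | inr u => H u end).
    by elim/tensW=> -[] x y; rewrite FE ?GE ?HE.
  by case; elim/tensW=> x y; rewrite ?GE ?HE FE.
- by move=> a; elim/tensW=> -[] x y; rewrite bl_tpair !FE /= tens_lactE.
by elim/tensW=> -[] x y a; rewrite br_tpair !FE /= tens_ractE.
Qed.

Lemma tensDr_iso X Y Y' : biset_iso (biset_tens X (biset_sum Y Y'))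
  (biset_sum (biset_tens X Y) (biset_tens X Y')).
Proof.
have [|F FE] := @tens_lift _ _ _ X (biset_sum Y Y')
  (biset_sum (biset_tens X Y) (biset_tens X Y'))
  (fun x z => match z with inl y => inl (tpair x y) | inr y => inr (tpair x y) end).
  by move=> x q [] y /=; rewrite tpairA.
have [|G GE] := @tens_lift _ _ _ X Y (biset_tens X (biset_sum Y Y'))
  (fun x y => tpair x (inl y : biset_sum Y Y')).
  by move=> x q y; rewrite tpairA.
have [|H HE] := @tens_lift _ _ _ X Y' (biset_tens X (biset_sum Y Y'))
  (fun x y => tpair x (inr y : biset_sum Y Y')).
  by move=> x q y; rewrite tpairA.
exists F; split.
- exists (fun z => match z with inl u => G u | inr u => H u end).
    by elim/tensW=> x [] y; rewrite FE ?GE ?HE.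
  by case; elim/tensW=> x y; rewrite ?GE ?HE FE.
- by move=> a; elim/tensW=> x [] y; rewrite bl_tpair !FE /= tens_lactE.
by elim/tensW=> x [] y a; rewrite br_tpair !FE /= tens_ractE.
Qed.

Lemma tens0l_iso Y : biset_iso (biset_tens (biset0 P Q) Y) (biset0 P R).
Proof.
exists (fun z => match (repr z).1 : void with end).
by split=> [|? z|z ?]; [exists (of_void _) => [z|[]]|..]; case: (repr z).1.
Qed.
Lemma tens0r_iso X : biset_iso (biset_tens X (biset0 Q R)) (biset0 P R).
Proof.
exists (fun z => match (repr z).2 : void with end).
by split=> [|? z|z ?]; [exists (of_void _) => [z|[]]|..]; case: (repr z).2.
Qed.

Definition bclass_tens (c : biset_class P Q) (d : biset_class Q R) :
  biset_class P R := bclass (biset_tens (brepr c) (brepr d)).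

Lemma bclass_tensE X Y : bclass_tens (bclass X) (bclass Y) = bclass (biset_tens X Y).
Proof. exact/bclassP/tens_iso/bclassK/bclassK. Qed.

Lemma bclass_tensDl d : nmod_morphism (bclass_tens^~ d).
Proof.
split; elim/bclassW: d => Y; first exact/(etrans (bclass_tensE _ _))/bclassP/tens0l_iso.
elim/bclassW=> X; elim/bclassW=> X'.
by rewrite -bclassD !bclass_tensE -bclassD; apply/bclassP/tensDl_iso.
Qed.
Lemma bclass_tensDr c : nmod_morphism (bclass_tens c).
Proof.
split; elim/bclassW: c => X; first exact/(etrans (bclass_tensE _ _))/bclassP/tens0r_iso.
elim/bclassW=> Y; elim/bclassW=> Y'.
by rewrite -bclassD !bclass_tensE -bclassD; apply/bclassP/tensDr_iso.
Qed.

End TensorLaws.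

Record preadd_cat := PreaddCat {
  ob :> Type;
  hom : ob -> ob -> zmodType;
  id_hom : forall x, hom x x;
  comp_hom : forall x y z, hom y z -> hom x y -> hom x z;
  comp_homA : forall x y z t (f : hom x y) (g : hom y z) (h : hom z t),
    comp_hom h (comp_hom g f) = comp_hom (comp_hom h g) f;
  comp_id_hom : forall x y (f : hom x y), comp_hom (id_hom y) f = f;
  comp_hom_id : forall x y (f : hom x y), comp_hom f (id_hom x) = f;
  comp_homDl : forall x y z (g g' : hom y z) (f : hom x y),
    comp_hom (g + g') f = comp_hom g f + comp_hom g' f;
  comp_homDr : forall x y z (g : hom y z) (f f' : hom x y),
    comp_hom g (f + f') = comp_hom g f + comp_hom g f' }.

Arguments id_hom {p} x.

Definition full_subcat (K : preadd_cat) (D : K -> Prop) : preadd_cat :=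
  @PreaddCat {x : K | D x} (fun x y => hom (sval x) (sval y))
    (fun x => id_hom (sval x)) (fun x y z g f => comp_hom g f)
    (fun x y z t => @comp_homA K _ _ _ _) (fun x y => @comp_id_hom K _ _)
    (fun x y => @comp_hom_id K _ _) (fun x y z => @comp_homDl K _ _ _)
    (fun x y z => @comp_homDr K _ _ _).

Section WideSubcat.
Variables (K : preadd_cat) (H : forall x y : K, zmodClosed (hom x y)).
Hypothesis H1 : forall x : K, id_hom x \in H x x.
Hypothesis HM : forall (x y z : K) (g : hom y z) (f : hom x y),
  g \in H y z -> f \in H x y -> comp_hom g f \in H x z.

Definition wide_subcat : preadd_cat.
Proof.
exists (ob K) (fun x y => subz (H x y) : zmodType) (fun x => Subz (H1 x))
  (fun x y z g f => Subz (HM (valP g) (valP f))).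
- by move=> x y z t f g h; apply: val_inj; apply: comp_homA.
- by move=> x y f; apply: val_inj; apply: comp_id_hom.
- by move=> x y f; apply: val_inj; apply: comp_hom_id.
- by move=> x y z g g' f; apply: val_inj; apply: comp_homDl.
- by move=> x y z g f f'; apply: val_inj; apply: comp_homDr.
Defined.

End WideSubcat.

Record cofunctor (K : preadd_cat) := Cofunctor {
  fob :> K -> zmodType;
  fmap : forall x y : K, hom x y -> {additive fob y -> fob x};
  fmapD : forall (x y : K) (f g : hom x y) a, fmap (f + g) a = fmap f a + fmap g a;
  fmap_id : forall (x : K) a, fmap (id_hom x) a = a;
  fmap_comp : forall (x y z : K) (g : hom y z) (f : hom x y) a,
    fmap (comp_hom g f) a = fmap f (fmap g a) }.

Record nat_trans (K : preadd_cat) (M N : cofunctor K) := NatTrans {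
  ntapp :> forall x : K, {additive M x -> N x};
  ntnat : forall (x y : K) (f : hom x y) a, ntapp x (fmap M f a) = fmap N f (ntapp y a) }.

Definition short_exact_seq (K : preadd_cat) (M1 M2 M3 : cofunctor K)
    (a : nat_trans M1 M2) (b : nat_trans M2 M3) : Prop :=
  forall x : K, short_exact (a x) (b x).

Section BurnsideCategory.

Definition bcomp (P Q R : finGroupType) (y : burnside Q R) (x : burnside P Q) :
  burnside P R := groth_bil (@bclass_tens P Q R) x y.

Lemma bcompE P Q R (X : biset P Q) (Y : biset Q R) :
  bcomp (bcls Y) (bcls X) = bcls (biset_tens X Y).
Proof.
rewrite /bcomp groth_bil_in ?bclass_tensE //.
  exact: bclass_tensDl.
exact: bclass_tensDr.
Qed.

Lemma bcompDl P Q R (y y' : burnside Q R) (x : burnside P Q) :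
  bcomp (y + y') x = bcomp y x + bcomp y' x.
Proof. exact: (groth_bilDr (@bclass_tensDl P Q R) (@bclass_tensDr P Q R)). Qed.
Lemma bcompDr P Q R (y : burnside Q R) (x x' : burnside P Q) :
  bcomp y (x + x') = bcomp y x + bcomp y x'.
Proof. exact: (groth_bilDl (@bclass_tensDl P Q R) (@bclass_tensDr P Q R)). Qed.

Lemma bcompBl P Q R (y y' : burnside Q R) (x : burnside P Q) :
  bcomp (y - y') x = bcomp y x - bcomp y' x.
Proof. by apply/eqP; rewrite eq_sym subr_eq -bcompDl subrK. Qed.
Lemma bcompBr P Q R (y : burnside Q R) (x x' : burnside P Q) :
  bcomp y (x - x') = bcomp y x - bcomp y x'.
Proof. by apply/eqP; rewrite eq_sym subr_eq -bcompDr subrK. Qed.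

Lemma burnside_ind P Q (T : burnside P Q -> Prop) : (forall X, T (bcls X)) ->
  (forall x y, T x -> T y -> T (x - y)) -> forall x, T x.
Proof. by move=> T1 TB; apply: groth_ind => //; elim/bclassW. Qed.

Definition burnside_cat : preadd_cat.
Proof.
exists finGroupType burnside (fun P => bcls (biset1 P)) bcomp.
- move=> P Q R S f g h.
  elim/burnside_ind: f => [X|f f' Hf Hf']; last by rewrite !bcompBr Hf Hf'.
  elim/burnside_ind: g => [Y|g g' Hg Hg']; last by rewrite bcompBl !bcompBr bcompBl Hg Hg'.
  elim/burnside_ind: h => [Z|h h' Hh Hh']; last by rewrite !bcompBl Hh Hh'.
  rewrite !bcompE; congr groth_in; apply/bclassP; exact/biso_sym/tensA_iso.
- move=> P Q; elim/burnside_ind=> [X|f g Hf Hg]; last by rewrite bcompBr Hf Hg.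
  by rewrite bcompE; congr groth_in; apply/bclassP/tensr1_iso.
- move=> P Q; elim/burnside_ind=> [X|f g Hf Hg]; last by rewrite bcompBl Hf Hg.
  by rewrite bcompE; congr groth_in; apply/bclassP/tens1_iso.
- by move=> P Q R g g' f; apply: bcompDl.
- by move=> P Q R g f f'; apply: bcompDr.
Defined.

Definition bifree_biset (P Q : finGroupType) (X : biset P Q) : Prop :=
  (forall g (x : X), bl g x = x -> g = 1%g) /\
  (forall (x : X) h, br x h = x -> h = 1%g).

Definition bifree (P Q : finGroupType) : zmodClosed (burnside P Q) :=
  zspan (fun v => exists2 X : biset P Q, bifree_biset X & v = bcls X).

Lemma bifree_bcls (P Q : finGroupType) (X : biset P Q) :
  bifree_biset X -> bcls X \in bifree P Q.
Proof. by move=> fX; apply: mem_zspan; exists X. Qed.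

Lemma bifree_id (P : burnside_cat) : id_hom P \in bifree P P.
Proof.
apply: bifree_bcls; split=> [g x /=|x h /=] e.
  by apply: (mulIg x); rewrite mul1g.
by apply: (mulgI x); rewrite mulg1.
Qed.

Lemma bifree_comp (P Q R : burnside_cat) (g : hom Q R) (f : hom P Q) :
  g \in bifree Q R -> f \in bifree P Q -> comp_hom g f \in bifree P R.
Proof.
move=> gF fF; move: g gF; apply: zspan_ind => [|g g' Hg Hg'|_ [Y [lY rY] ->]].
- by rewrite -[0](subrr 0) /= bcompBl subrr rpred0.
- by rewrite /= bcompBl rpredB.
move: f fF; apply: zspan_ind => [|f f' Hf Hf'|_ [X [lX rX] ->]].
- by rewrite -[0](subrr 0) /= bcompBr subrr rpred0.
- by rewrite /= bcompBr rpredB.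
rewrite /= bcompE; apply: bifree_bcls; split.
  move=> g; elim/tensW=> x y; rewrite bl_tpair => /tpairP[q ex ey].
  by move/esym/lY: ey ex => ->; rewrite ract1 => /lX.
elim/tensW=> x y h; rewrite br_tpair => /tpairP[q ex ey].
by move/esym/rX: ex ey => ->; rewrite lact1 => /esym/rY.
Qed.

Definition bifree_cat : preadd_cat := wide_subcat bifree_id bifree_comp.

End BurnsideCategory.

(** A collection of finite groups closed under subgroups and quotients; a
    subgroup [H] of [G] is considered as a group by means of [subg_of H], and
    its quotient by a normal subgroup [N] is [coset_of N]. *)
Record collection := Collection {
  in_coll :> finGroupType -> Prop;
  coll_sub : forall (G : finGroupType) (H : {group G}),
    in_coll G -> in_coll (subg_of H);
  coll_quo : forall (G : finGroupType) (N : {group G}),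
    (N <| [set: G])%g -> in_coll G -> in_coll (coset_of N) }.

Definition biset_functor (C : collection) :=
  cofunctor (@full_subcat burnside_cat C).
Definition global_mackey_functor (C : collection) :=
  cofunctor (@full_subcat bifree_cat C).

(** [biset_twist phi] is [[R, phi]_P^Q]. As [R] is a group, [twist_eq] is
    already the equivalence relation generated by [(x r, q) ~ (x, phi r q)]. *)

Section TwistedBiset.
Variables (P Q : finGroupType) (R : {group P}) (phi : {morphism R >-> Q}).
Local Open Scope group_scope.

Definition twist_eq (u v : P * Q) : bool :=
  [exists r in R, (u.1 == v.1 * r) && (v.2 == phi r * u.2)].

Lemma twist_eqP x y x' y' :
  reflect (exists2 r, r \in R & x = x' * r /\ y' = phi r * y)
          (twist_eq (x, y) (x', y')).
Proof.
apply: (iffP exists_inP) => -[r Rr]; first by case/andP=> /= /eqP-> /eqP->; exists r.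
by case=> -> ->; exists r; rewrite //= !eqxx.
Qed.

Lemma twist_eq_equiv : equiv_class_of twist_eq.
Proof.
split.
- by move=> [x y]; apply/twist_eqP; exists 1; rewrite ?morph1 ?mulg1 ?mul1g.
- apply: symmetric_from_pre => -[x y] [x' y'] /twist_eqP[r Rr [-> ->]].
  apply/twist_eqP; exists r^-1; first by rewrite groupV.
  by rewrite morphV // mulgK mulKg.
move=> [x2 y2] [x1 y1] [x3 y3] /twist_eqP[r Rr [-> ->]] /twist_eqP[s Rs [-> ->]].
by apply/twist_eqP; exists (s * r); rewrite ?groupM // morphM // !mulgA.
Qed.
Canonical twist_equiv := EquivRelPack twist_eq_equiv.

Definition twist := {eq_quot twist_eq}.
HB.instance Definition _ := EqQuotient.on twist.
HB.instance Definition _ := Choice.on twist.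
HB.instance Definition _ := Countable.copy twist (can_type (@reprK _ twist)).
HB.instance Definition _ := isFinite.Build twist (pcan_enumP (can_pcan (@reprK _ twist))).

Definition twpair (x : P) (y : Q) : twist := \pi_twist (x, y).

Lemma twpairP x y x' y' :
  twpair x y = twpair x' y' <-> exists2 r, r \in R & x = x' * r /\ y' = phi r * y.
Proof. by split=> [/eqmodP/twist_eqP | H]; last apply/eqmodP/twist_eqP. Qed.
Lemma twistW (T : twist -> Prop) : (forall x y, T (twpair x y)) -> forall z, T z.
Proof. by move=> H; elim/quotW=> -[]. Qed.

Lemma twist_repr x y : exists2 r, r \in R &
  x = (repr (twpair x y)).1 * r /\ (repr (twpair x y)).2 = phi r * y.
Proof. by apply/twpairP; rewrite /twpair -surjective_pairing reprK. Qed.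

Definition twist_lact (g : P) (z : twist) : twist :=
  twpair (g * (repr z).1) (repr z).2.
Definition twist_ract (z : twist) (h : Q) : twist :=
  twpair (repr z).1 ((repr z).2 * h).

Lemma twist_lactE g x y : twist_lact g (twpair x y) = twpair (g * x) y.
Proof.
have [r Rr [e1 e2]] := twist_repr x y.
by symmetry; apply/twpairP; exists r; rewrite // -mulgA -e1.
Qed.
Lemma twist_ractE x y h : twist_ract (twpair x y) h = twpair x (y * h).
Proof.
have [r Rr [e1 e2]] := twist_repr x y.
by symmetry; apply/twpairP; exists r; rewrite // mulgA -e2.
Qed.

Definition biset_twist : biset P Q.
Proof.
exists twist; exists twist_lact twist_ract.
- by elim/twistW=> x y; rewrite twist_lactE mul1g.
- by move=> g h; elim/twistW=> x y; rewrite !twist_lactE mulgA.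
- by elim/twistW=> x y; rewrite twist_ractE mulg1.
- by elim/twistW=> x y g h; rewrite !twist_ractE mulgA.
- by move=> g; elim/twistW=> x y h; rewrite !(twist_ractE, twist_lactE).
Defined.

Lemma bifree_twist : 'injm phi -> bifree_biset biset_twist.
Proof.
move=> /injmP inj; split.
  move=> g; elim/twistW=> x y /=; rewrite twist_lactE => /twpairP[r Rr [ex ey]].
  have r1 : r = 1.
    apply: inj; rewrite ?group1 // morph1; apply: (mulIg y); rewrite -ey; exact/esym/mul1g.
  by apply: (mulIg x); rewrite ex r1 mulg1 mul1g.
elim/twistW=> x y h /=; rewrite twist_ractE => /twpairP[r Rr [ex ey]].
have r1 : r = 1 by apply: (mulgI x); rewrite -ex mulg1.
by apply: (mulgI y); rewrite {2}ey r1 morph1 mul1g mulg1.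
Qed.

End TwistedBiset.

Section SubgroupMorphism.
Variables (S T : finGroupType) (P : {group S}) (phi : {morphism P >-> T}).

Definition on_subg (x : subg_of P) : T := phi (sgval x).
Lemma on_subg_morph : {in [set: subg_of P] &, {morph on_subg : x y / (x * y)%g}}.
Proof. by move=> x y _ _; rewrite /on_subg morphM ?subgP. Qed.
Canonical on_subg_morphism := Morphism on_subg_morph.

Lemma injm_on_subg : ('injm phi)%g -> ('injm on_subg)%g.
Proof.
move=> /injmP inj; apply/injmP=> x y _ _ e; apply: val_inj.
by apply: inj e; rewrite subgP.
Qed.

End SubgroupMorphism.

Section Restriction.
Local Open Scope group_scope.

(** What the definition of [res_phi] needs of a category: an object for [S],
    one for each [P <= S], and the morphism [[P, phi]_P^S] for each injective
    [phi : P -> S]. *)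
Record restrictions (K : preadd_cat) (S : finGroupType) := Restrictions {
  res_top : K;
  res_sub : {group S} -> K;
  res_hom : forall (P : {group S}) (phi : {morphism P >-> S}),
    'injm phi -> hom (res_sub P) res_top }.

Variables (S : finGroupType) (C : collection) (CS : C S).

Definition res_obj : {G : finGroupType | C G} := exist C S CS.
Definition res_subobj (P : {group S}) : {G : finGroupType | C G} :=
  exist C (subg_of P) (coll_sub P CS).

Definition biset_restrictions : restrictions (@full_subcat burnside_cat C) S :=
  @Restrictions (@full_subcat burnside_cat C) S res_obj res_subobj
    (fun P phi _ => bcls (biset_twist (on_subg_morphism phi))).

Definition mackey_restrictions : restrictions (@full_subcat bifree_cat C) S :=
  @Restrictions (@full_subcat bifree_cat C) S res_obj res_subobj
    (fun P phi inj => Subz (bifree_bcls (bifree_twist (injm_on_subg inj)))).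

End Restriction.

Section Fusion.
Local Open Scope group_scope.

(** [F P Q phi] means [phi \in F(P, Q)], a homomorphism [P -> Q] being
    represented by a morphism [phi] from [P] to the ambient group [S], which
    only matters up to equality on [P], with image in [Q].
    Conjugation [u ^ x] is [x^-1 u x] here, so [conjgm P x] is conjugation by
    [x^-1]; this does not affect the sets of homomorphisms below. *)
Record fusion_system (S : finGroupType) := FusionSystem {
  fus :> forall P Q : {group S}, {morphism P >-> S} -> Prop;
  fus_eq : forall (P Q : {group S}) (phi psi : {morphism P >-> S}),
    {in P, phi =1 psi} -> fus Q phi -> fus Q psi;
  fus_im : forall (P Q : {group S}) (phi : {morphism P >-> S}),
    fus Q phi -> phi @* P \subset Q;
  fus_injm : forall (P Q : {group S}) (phi : {morphism P >-> S}),
    fus Q phi -> 'injm phi;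
  fus_conj : forall (P Q : {group S}) (x : S),
    P :^ x \subset Q -> fus Q (conjgm_morphism P x);
  fus_comp : forall (P Q R : {group S}) (phi : {morphism P >-> S})
      (psi : {morphism Q >-> S}) (chi : {morphism P >-> S}),
    fus Q phi -> fus R psi -> {in P, chi =1 psi \o phi} -> fus R chi;
  fus_corestr : forall (P Q : {group S}) (phi : {morphism P >-> S}),
    fus Q phi -> fus (phi @* P)%G phi;
  fus_inv : forall (P Q : {group S}) (phi : {morphism P >-> S}) (inj : 'injm phi),
    fus Q phi -> fus P (invm_morphism inj) }.

Variables (S : finGroupType) (F : fusion_system S).

Definition fus_iso (P Q : {group S}) : Prop :=
  exists (phi : {morphism P >-> S}) (psi : {morphism Q >-> S}),
    [/\ F P Q phi, F Q P psi, {in P, cancel phi psi} & {in Q, cancel psi phi}].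

(** [S] being the whole type, [C_S(P)] and [N_S(P)] are ['C(P)] and ['N(P)]. *)
Definition fully_centralized (P : {group S}) : Prop :=
  forall P' : {group S}, fus_iso P P' -> (#|'C(P')| <= #|'C(P)|)%N.

Definition fully_normalized (P : {group S}) : Prop :=
  forall P' : {group S}, fus_iso P P' -> (#|'N(P')| <= #|'N(P)|)%N.

Definition Aut_fus (P : {group S}) : {set {perm S}} :=
  [set a in Aut P | `[< exists2 phi : {morphism P >-> S},
                          F P P phi & {in P, phi =1 a} >]].

Lemma Aut_fus_group_set (P : {group S}) : group_set (Aut_fus P).
Proof.
apply/group_setP; split=> [|a b].
  rewrite inE group1; apply/asboolP; exists (conjgm_morphism P 1).
    by apply: fus_conj; rewrite conjsg1.
  by move=> x _; rewrite /= /conjgm conjg1 perm1.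
rewrite ![_ \in Aut_fus P]inE => /andP[Aa /asboolP[phi Fphi ea]] /andP[Ab /asboolP[psi Fpsi eb]].
rewrite groupM //=; apply/asboolP.
exists (autm_morphism (groupM Aa Ab)) => // .
apply: (fus_comp Fphi Fpsi) => x Px /=.
by rewrite autmE permM ea // eb // Aut_closed.
Qed.
Canonical Aut_fus_group (P : {group S}) := Group (Aut_fus_group_set P).

Definition Aut_S (P : {group S}) : {group {perm S}} := (conj_aut P @* 'N(P))%G.

Definition extender (P : {group S}) (phi : {morphism P >-> S}) : {set S} :=
  [set x in 'N(P) | [exists y in 'N(phi @* P),
                      [forall u in P, phi (u ^ x) == phi u ^ y]]].

Lemma extender_group_set (P : {group S}) (phi : {morphism P >-> S}) : group_set (extender phi).
Proof.
apply/group_setP; split=> [|x y].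
  rewrite inE group1; apply/exists_inP; exists 1; first exact: group1.
  by apply/forall_inP=> u _; rewrite !conjg1.
rewrite ![_ \in extender phi]inE => /andP[Nx /exists_inP[a Na /forall_inP xa]].
move=> /andP[Ny /exists_inP[b Nb /forall_inP yb]].
rewrite groupM //=; apply/exists_inP; exists (a * b); first exact: groupM.
apply/forall_inP=> u Pu; rewrite !conjgM (eqP (yb _ _)) ?memJ_norm //.
by rewrite (eqP (xa _ _)).
Qed.
Canonical extender_group (P : {group S}) (phi : {morphism P >-> S}) :=
  Group (extender_group_set phi).

Definition saturated (p : nat) : Prop :=
  (forall P : {group S}, fully_normalized P ->
     fully_centralized P /\ p.-Sylow(Aut_fus P) (Aut_S P)) /\
  (forall (P : {group S}) (phi : {morphism P >-> S}), F P [set: S]%G phi ->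
     fully_centralized (phi @* P)%G ->
     exists2 psi : {morphism (extender phi) >-> S},
       F (extender_group phi) [set: S]%G psi & {in P, psi =1 phi}).

End Fusion.

Section Stable.
Variables (S : finGroupType) (F : fusion_system S).
Variables (K : preadd_cat) (r : restrictions K S).

Definition res (M : cofunctor K) (P : {group S}) (phi : {morphism P >-> S})
    (inj : ('injm phi)%g) : {additive M (res_top r) -> M (res_sub r P)} :=
  fmap M (res_hom r inj).

Definition stable (M : cofunctor K) : {pred M (res_top r)} := fun X =>
  `[< forall (P : {group S}) (phi : {morphism P >-> S}) (Fphi : F P [set: S]%G phi),
        res M (fus_injm Fphi) X = res M (injm_idm P) X >].

Lemma stable_closed (M : cofunctor K) : zmod_closed (@stable M).
Proof.
split=> [|X Y /asboolP HX /asboolP HY]; apply/asboolP=> P phi Fphi.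
  by rewrite !raddf0.
by rewrite !raddfB HX HY.
Qed.
HB.instance Definition _ M := GRing.isZmodClosed.Build _ (@stable M) (stable_closed M).

Definition stable_group (M : cofunctor K) : zmodType := subz (@stable M).

Section Map.
Variables (M N : cofunctor K) (a : nat_trans M N).

Lemma stable_map_subproof (X : stable_group M) :
  a (res_top r) (val X) \in @stable N.
Proof.
by have /asboolP HX := valP X; apply/asboolP=> P phi Fphi; rewrite -!ntnat HX.
Qed.

Definition stable_map (X : stable_group M) : stable_group N :=
  Subz (stable_map_subproof X).

Lemma stable_map_is_additive : nmod_morphism stable_map.
Proof.
by split=> [|X Y]; apply: val_inj; rewrite /= ?raddf0 ?raddfD.
Qed.
HB.instance Definition _ := GRing.isNmodMorphism.Build
  (stable_group M) (stable_group N) stable_map stable_map_is_additive.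

End Map.
End Stable.

Arguments stable {S} F {K} r M _ : simpl never.
Arguments stable_group {S} F {K} r M.
Arguments stable_map {S} F {K} r {M N} a _.

(* Main.v *)
Require Import Defs.
From HB Require Import structures.
From mathcomp Require Import all_boot all_order all_algebra.
From mathcomp Require Import all_fingroup all_solvable.
From mathcomp.classical Require Import boolp.

(** Everything but surjectivity is formal: [M(F)] is cut out of [M(S)] by
    equations and localization is exact.  Surjectivity says that a stable [X]
    in [M3(S)] has, up to an integer prime to [p], a stable preimage in
    [M2(S)] ([ex_stable_preimage]).

    It rests on an element [Omega] of [A(S, S)], an integral combination of
    bisets [[P, phi]_S^S] with [phi] in [F(P, S)], such that
    [Omega o [P, phi]_P^S = Omega o [P, incl]_P^S] for all [phi] in [F(P, S)]
    and such that the degree [|Omega| / |S|] is prime to [p]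
    ([ex_characteristic]).  The first property says that [M(Omega)] maps [M(S)]
    into the stable elements, naturally in [M] ([fmap_stable]).  If [X] is
    stable then [res_phi X = res_P X], so [M(Omega) X = M(U) X], where [U] is
    [Omega] with each [[P, phi]] replaced by [[P, incl]] ([span_stable]).
    Composition with [U] multiplies the mark at [E <= S * S] by an integer
    [n(Q)] that only depends on the left projection [Q] of [E] and is congruent
    to the degree modulo [p] ([span_multipliers]).  An element of [A(S, S)] with
    vanishing marks is zero ([mark_inj]), so the product over all [Q <= S] of
    the operators [M(U) - n(Q)] is zero; applied to a stable [X] and expanded
    ([shift_stable]), this reads [c X = M(Omega) w] with [c] equal, up to sign,
    to the product of the [n(Q)], hence prime to [p].  Now lift [w] to [M2(S)]
    in any way and apply [M(Omega)].

    In terms of marks, [Omega] has to be constant on the classes of the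
    relation [tconj] on subgroups of [S * S]: a morphism of [F] on the left
    factor, conjugation on the right one.  Only the graphs of morphisms of [F]
    carry nonzero marks.  These are corrected by descending order
    ([stabilize]): adding a multiple of the orbit with stabilizer [D] changes
    the mark at [D] by multiples of [|N(D) : D|] and leaves the marks at other
    classes of subgroups of at least that order unchanged.  That such
    corrections suffice is a congruence: each class contains a reference [D0]
    such that every [D1] in the class is carried to [D0] by a morphism defined
    on all of [N(D1)] ([ex_receptive], where saturation enters), and comparing
    the actions of [N(D1)] on the fixed points of [D1] and of [D0] gives
    equality of the two marks modulo [|N(D1) : D1|] ([mark_congr_tconj]).  The
    induction starts with one copy of [[S, alpha]] for each [alpha] in
    [Out_F(S)], of degree [|Out_F(S)|], prime to [p]; the later corrections
    have degree divisible by [p]. *)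

Set Implicit Arguments.
Unset Strict Implicit.
Unset Printing Implicit Defensive.
Import generic_quotient GRing.Theory.
Local Open Scope ring_scope.
Local Open Scope quotient_scope.

(** * Marks of bisets *)

Section GrothExtension.
Local Open Scope ring_scope.
Variables (N : nmodType) (V : zmodType) (f : {additive N -> V}).

Definition groth_ext (x : groth N) : V := f (repr x).1 - f (repr x).2.

Lemma groth_ext_pi u : groth_ext (\pi_(groth N) u) = f u.1 - f u.2.
Proof.
have [z /(congr1 f)] := groth_repr u; rewrite !raddfD => /addIr e.
by apply/eqP; rewrite /groth_ext subr_eq addrAC e addrK.
Qed.

Lemma groth_ext_in a : groth_ext (groth_in a) = f a.
Proof. by rewrite groth_ext_pi raddf0 subr0. Qed.

Lemma groth_ext_is_additive : nmod_morphism groth_ext.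
Proof.
split; first by rewrite -[0](erefl (groth_in 0)) groth_ext_in raddf0.
elim/quotW=> u; elim/quotW=> v; rewrite -pi_grothD !groth_ext_pi !raddfD /=.
by rewrite addrACA.
Qed.
HB.instance Definition _ := GRing.isNmodMorphism.Build (groth N) V groth_ext
  groth_ext_is_additive.

End GrothExtension.

Section FixedPoints.
Local Open Scope group_scope.
Variables P Q : finGroupType.
Implicit Types (X Y : biset P Q) (A B : {set P * Q}) (E : {group P * Q}).

(** The inverse makes this a right action, under which [(g, h)] fixes [x] when
    [g x = x h]. *)
Definition biset_act_fun X (x : X) (a : P * Q) : X := bl a.1^-1 (br x a.2).

Lemma biset_act_id X : @biset_act_fun X ^~ 1 =1 id.
Proof. by move=> x; rewrite /biset_act_fun invg1 lact1 ract1. Qed.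
Lemma biset_act_morph X x : act_morph (@biset_act_fun X) x.
Proof.
by move=> a b; rewrite /biset_act_fun /= invMg lactM ractM !lractA.
Qed.
Canonical biset_act X := TotalAction (@biset_act_id X) (@biset_act_morph X).

Definition fixpts X A : {set X} := 'Fix_(biset_act X)(A).

Lemma fixptsP X A (x : X) :
  reflect (forall g h, (g, h) \in A -> bl g x = br x h) (x \in fixpts X A).
Proof.
apply: (iffP afixP) => [fx g h Agh|fx [g h] Agh].
  by have /(congr1 (bl g)) := fx _ Agh; rewrite /= /biset_act_fun -lactM mulgV lact1.
by rewrite /= /biset_act_fun -(fx _ _ Agh) -lactM mulVg lact1.
Qed.

Lemma fixpts_iso X Y A : biset_iso X Y -> #|fixpts X A| = #|fixpts Y A|.
Proof.
move=> [f [[f' fK f'K] fl fr]]; rewrite -(card_imset _ (can_inj fK)).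
apply: eq_card => y; apply/imsetP/fixptsP=> [[x /fixptsP fx ->] g h Agh|fy].
  by rewrite -fl -fr (fx _ _ Agh).
exists (f' y) => //; apply/fixptsP=> g h Agh.
by apply: (can_inj fK); rewrite fl fr f'K; apply: fy.
Qed.

Lemma fixpts_sum X Y A :
  #|fixpts (biset_sum X Y) A| = (#|fixpts X A| + #|fixpts Y A|)%N.
Proof.
pose Z := biset_sum X Y.
have fl x : ((inl x : Z) \in fixpts Z A) = (x \in fixpts X A).
  apply/fixptsP/fixptsP=> fx g h Agh; last by rewrite /= (fx g h).
  by have [] := fx g h Agh.
have fr y : ((inr y : Z) \in fixpts Z A) = (y \in fixpts Y A).
  apply/fixptsP/fixptsP=> fy g h Agh; last by rewrite /= (fy g h).
  by have [] := fy g h Agh.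
rewrite -!sum1_card big_sumType /=.
by congr (_ + _)%N; apply: eq_bigl => z; rewrite (fl, fr).
Qed.

Local Open Scope ring_scope.
Definition fixcount A (c : biset_class P Q) : int := (#|fixpts (brepr c) A|)%:Z.

Lemma fixcountE A X : fixcount A (bclass X) = #|fixpts X A|%:Z.
Proof. by rewrite /fixcount (fixpts_iso _ (bclassK X)). Qed.

Lemma fixcount_is_additive A : nmod_morphism (fixcount A).
Proof.
split.
  rewrite -[0](erefl (bclass (biset0 P Q))) fixcountE; congr Posz.
  by apply/eqP; rewrite -leqn0 -(card_void) max_card.
elim/bclassW=> X; elim/bclassW=> Y.
by rewrite -bclassD !fixcountE fixpts_sum PoszD.
Qed.
HB.instance Definition _ A := GRing.isNmodMorphism.Build (biset_class P Q) int
  (fixcount A) (fixcount_is_additive A).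

(** For [A] a subgroup of [P * Q] this is the classical mark at [A].  Subsets
    are allowed so that the fixed points of [D] and one more element [a] are
    counted at [a |: D], as the Cauchy-Frobenius formula produces them. *)
Definition mark A (x : burnside P Q) : int := groth_ext (fixcount A) x.

Lemma markB A x y : mark A (x - y) = mark A x - mark A y.
Proof. exact: raddfB. Qed.
Lemma markD A x y : mark A (x + y) = mark A x + mark A y.
Proof. exact: raddfD. Qed.
Lemma mark0 A : mark A 0 = 0.
Proof. exact: raddf0. Qed.
Lemma markMz A x (m : int) : mark A (x *~ m) = mark A x *~ m.
Proof. exact: raddfMz. Qed.

Lemma mark_bcls A X : mark A (bcls X) = #|fixpts X A|%:Z.
Proof. exact: etrans (groth_ext_in _ _) (fixcountE _ _). Qed.

Lemma mark_gen A x : mark <<A>>%g x = mark A x.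
Proof.
elim/burnside_ind: x => [X|x y Hx Hy]; last by rewrite !markB Hx Hy.
by rewrite !mark_bcls /fixpts afix_gen.
Qed.

Lemma markJ A a x : mark (A :^ a)%g x = mark A x.
Proof.
elim/burnside_ind: x => [X|x y Hx Hy]; last by rewrite !markB Hx Hy.
rewrite !mark_bcls; congr Posz.
rewrite -(card_imset (mem (fixpts X A)) (act_inj (biset_act X) a)).
apply: eq_card => x; apply/afixP/imsetP=> [fx|[y /afixP fy ->] _ /imsetP[b Ab ->]].
  exists (biset_act X x a^-1%g); last by rewrite actKV.
  apply/afixP=> b Ab.
  have e : biset_act X x (a^-1 * (b * a))%g = x.
    by rewrite -conjgE fx ?memJ_conjg.
  by rewrite -{2}e -!actM -!mulgA mulgV mulg1.
by rewrite -actM -conjgC actM fy.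
Qed.

(** The Cauchy-Frobenius formula for [K] acting on the fixed points of [D]: the
    sum counts orbits. *)
Lemma mark_congr (D : {set P * Q}) (K : {group P * Q}) x : K \subset 'N(D)%g ->
  exists m : int, \sum_(a in K) mark (a |: D) x = m *+ #|K|.
Proof.
move=> nDK; elim/burnside_ind: x => [X|x y [m Hx] [n Hy]]; last first.
  exists (m - n); rewrite mulrnBl -Hx -Hy -sumrB; apply: eq_bigr => a _.
  exact: markB.
have aX : [acts K, on fixpts X D | biset_act X] by apply: acts_fix_norm.
have e := Frobenius_Cauchy aX.
exists (#|orbit (biset_act X) K @: fixpts X D|%:Z).
rewrite pmulrn mulrzz -PoszM -e (big_morph Posz PoszD (erefl _)).
apply: eq_bigr => a _; rewrite mark_bcls /fixpts afixU setIC.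
by congr (Posz #|_|); congr (_ :&: _).
Qed.

End FixedPoints.

(** * Marks determine bisets *)

Section MarksDetermine.
Local Open Scope group_scope.
Variables P Q : finGroupType.
Implicit Types (X Y : biset P Q) (E : {group P * Q}).

Lemma bl_act X g (x : X) : bl g x = biset_act X x (g^-1, 1).
Proof. by rewrite /= /biset_act_fun invgK ract1. Qed.
Lemma br_act X h (x : X) : br x h = biset_act X x (1, h).
Proof. by rewrite /= /biset_act_fun invg1 lact1. Qed.

Lemma biset_iso_act X Y (f : X -> Y) : bijective f ->
  (forall x a, f (biset_act X x a) = biset_act Y (f x) a) -> biset_iso X Y.
Proof.
by move=> bf fa; exists f; split=> // [g x|x h]; rewrite ?bl_act ?br_act fa.
Qed.

Section SubBiset.
Variables (X : biset P Q) (A : {set X}).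
Hypothesis actA : forall x a, x \in A -> biset_act X x a \in A.

Let blA g (x : {x | x \in A}) : bl g (val x) \in A.
Proof. by rewrite bl_act actA ?(valP x). Qed.
Let brA h (x : {x | x \in A}) : br (val x) h \in A.
Proof. by rewrite br_act actA ?(valP x). Qed.

Definition sub_biset : biset P Q.
Proof.
exists {x | x \in A}.
exists (fun g x => exist (fun x => x \in A) _ (blA g x))
  (fun x h => exist (fun x => x \in A) _ (brA h x)).
- by move=> x; apply: val_inj; rewrite /= lact1.
- by move=> g h x; apply: val_inj; rewrite /= lactM.
- by move=> x; apply: val_inj; rewrite /= ract1.
- by move=> x g h; apply: val_inj; rewrite /= ractM.
- by move=> g x h; apply: val_inj; rewrite /= lractA.
Defined.

Lemma val_sub_act (x : sub_biset) a :
  val (biset_act sub_biset x a) = biset_act X (val x) a.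
Proof. by []. Qed.

End SubBiset.

Definition orb X (x : X) : {set X} := orbit (biset_act X) setT x.

Lemma act_orb X (x y : X) a : y \in orb x -> biset_act X y a \in orb x.
Proof. by move=> xy; rewrite orbit_actr ?inE. Qed.
Lemma act_orbC X (x y : X) a : y \in ~: orb x -> biset_act X y a \in ~: orb x.
Proof. by rewrite !inE orbit_actr ?inE. Qed.

Definition orbit_biset X (x : X) := sub_biset (@act_orb X x).
Definition rest_biset X (x : X) := sub_biset (@act_orbC X x).

Lemma split_orbit X (x : X) :
  biset_iso (biset_sum (orbit_biset x) (rest_biset x)) X.
Proof.
exists (fun z : biset_sum (orbit_biset x) (rest_biset x) =>
  match z with inl y => val y | inr y => val y end).
split; last by case.
  2: by move=> g [].
have hg (y : X) : exists z : biset_sum (orbit_biset x) (rest_biset x),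
    match z with inl y => val y | inr y => val y end = y.
  case: (boolP (y \in orb x)) => [xy|].
    by exists (inl (exist _ y xy)).
  by rewrite -in_setC => xy; exists (inr (exist _ y xy)).
have [g gK] := choice hg.
exists g => // -[] [y yP]; have := gK y; case: (g _) => [] [z zP] /= e.
- by congr inl; apply: val_inj.
- by have := zP; rewrite {1}e inE yP.
- by have := yP; rewrite inE -{1}e zP.
by congr inr; apply: val_inj.
Qed.

(** An orbit is determined by the stabilizer of a point: send [x a] to [y a]. *)
Lemma orbit_biset_iso X Y (x : X) (y : Y) :
  'C[x | biset_act X] = 'C[y | biset_act Y] ->
  biset_iso (orbit_biset x) (orbit_biset y).
Proof.
have H (X1 Y1 : biset P Q) (x1 : X1) (y1 : Y1) :
  'C[x1 | biset_act X1] = 'C[y1 | biset_act Y1] ->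
  exists f : orbit_biset x1 -> orbit_biset y1, forall z a,
    val z = biset_act X1 x1 a -> val (f z) = biset_act Y1 y1 a.
  move=> eC; suff H : forall z : orbit_biset x1, exists w : orbit_biset y1,
      forall a, val z = biset_act X1 x1 a -> val w = biset_act Y1 y1 a.
    by have [f fE] := choice H; exists f.
  move=> [z xz].
  have [a _ ez] := imsetP xz.
  exists (exist (fun w => w \in orb y1) _ (mem_orbit (biset_act Y1) y1 (in_setT a))) => b /= eb.
  have : a * b^-1 \in 'C[x1 | biset_act X1].
    by apply/astab1P; rewrite actM -ez eb actK.
  by rewrite eC => /astab1P; rewrite actM => /(canRL (actKV _ _)).
move=> eC; have [f fE] := H _ _ _ _ eC; have [g gE] := H _ _ _ _ (esym eC).
have H' (X1 : biset P Q) (x1 : X1) (z : orbit_biset x1) : exists a, val z = biset_act X1 x1 a.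
  by have [a _ ->] := imsetP (valP z); exists a.
apply: (@biset_iso_act _ _ f).
  exists g => z; apply: val_inj; have [a ea] := H' _ _ z; rewrite ea.
    exact/gE/fE.
  exact/fE/gE.
move=> z b; apply: val_inj; have [a ea] := H' _ _ z.
rewrite val_sub_act (fE _ _ ea) -actM; apply: fE.
by rewrite val_sub_act ea actM.
Qed.

Lemma fixpts_stab X E (x : X) : (x \in fixpts X E) = (E \subset 'C[x | biset_act X]).
Proof. by rewrite /fixpts -sub1set astabC. Qed.

(** Burnside's theorem, by induction on the number of points.  Let [H] be
    maximal in order among the subgroups with fixed points in [X], hence also
    in [Y].  A fixed point of [H] then has stabilizer exactly [H], in [X] as in
    [Y], so both contain an orbit isomorphic to the cosets of [H]; cancel it. *)
Lemma marks_iso X Y :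
  (forall E : {group P * Q}, #|fixpts X E| = #|fixpts Y E|) -> biset_iso X Y.
Proof.
have [n] := ubnP #|X|; elim: n X Y => // n IHn X Y ltXn eXY.
have [x0 _|X0] := pickP (@predT X); last first.
  have Y0 (y : Y) : False.
    have := eXY 1%G; rewrite (_ : #|fixpts X _| = 0); last first.
      by apply: eq_card0 => x; have := X0 x.
    move/esym/eqP; rewrite cards_eq0 => /eqP/setP/(_ y).
    by rewrite fixpts_stab sub1G inE.
  have X0' (x : X) : False by have := X0 x.
  exists (fun x => match X0' x with end).
  split=> [|g x|x]; [|by case: (X0' x)..].
  by exists (fun y => match Y0 y with end) => [x|y]; [case: (X0' x) | case: (Y0 y)].
pose fixing (E : {group P * Q}) := fixpts X E != set0.
have fixing1 : fixing 1%G by apply/set0Pn; exists x0; rewrite fixpts_stab sub1G.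
have [H gH maxH] := arg_maxnP (fun E : {group P * Q} => #|E|) fixing1.
have [x xH] := set0Pn _ gH.
have [y yH] : exists y, y \in fixpts Y H.
  by apply/set0Pn; rewrite -card_gt0 -eXY card_gt0.
have stabX (z : X) : z \in fixpts X H -> H = 'C[z | biset_act X] :> {set _}.
  rewrite fixpts_stab => sHz; apply/eqP; rewrite eqEcard sHz.
  by apply: (maxH [group of 'C[z | biset_act X]]); apply/set0Pn; exists z; rewrite fixpts_stab.
have stabY (z : Y) : z \in fixpts Y H -> H = 'C[z | biset_act Y] :> {set _}.
  rewrite fixpts_stab => sHz; apply/eqP; rewrite eqEcard sHz.
  apply: (maxH [group of 'C[z | biset_act Y]]).
  rewrite /fixing -card_gt0 eXY card_gt0.
  by apply/set0Pn; exists z; rewrite fixpts_stab.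
have iO : biset_iso (orbit_biset x) (orbit_biset y).
  by apply: orbit_biset_iso; rewrite -(stabX _ xH) -(stabY _ yH).
have iR : biset_iso (rest_biset x) (rest_biset y).
  apply: IHn => [|E].
    rewrite -ltnS; apply: leq_trans ltXn; rewrite ltnS card_sig -[X in (_ < X)%N]cardsT.
    rewrite (@proper_card _ _ [set: X]) // properT.
    by apply/eqP=> /setP/(_ x); rewrite !inE orbit_refl.
  apply: (@addnI #|fixpts (orbit_biset x) E|).
  rewrite {2}(fixpts_iso _ iO) -!fixpts_sum (fixpts_iso _ (split_orbit x)).
  by rewrite (fixpts_iso _ (split_orbit y)).
apply: biso_trans (biso_sym (split_orbit x)) _.
exact: biso_trans (sum_iso iO iR) (split_orbit y).
Qed.

Local Open Scope ring_scope.

(** A virtual biset is a difference of two bisets, to which [marks_iso] applies. *)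
Lemma mark_inj (x y : burnside P Q) :
  (forall E : {group P * Q}, mark E x = mark E y) -> x = y.
Proof.
move=> exy; apply/eqP; rewrite -subr_eq0; apply/eqP.
have {exy}: forall E : {group P * Q}, mark E (x - y) = 0.
  by move=> E; rewrite markB exy subrr.
elim/quotW: (x - y) => -[c d]; rewrite pi_grothE /=.
elim/bclassW: c => X; elim/bclassW: d => Y mXY.
suff /bclassP-> : biset_iso X Y by rewrite subrr.
apply: marks_iso => E; apply/eqP; rewrite -eqz_nat -!mark_bcls.
by rewrite -subr_eq0 -markB mXY.
Qed.

End MarksDetermine.

(** * The bisets attached to a morphism *)

Section TwistMarks.
Local Open Scope group_scope.
Variables (S : finGroupType) (P : {group S}) (phi : {morphism P >-> S}).

Definition graph : {set S * S} := [set (r, phi r) | r in P].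

Lemma graphP g h : reflect (g \in P /\ h = phi g) ((g, h) \in graph).
Proof.
apply: (iffP imsetP) => [[r Pr [-> ->]]|[Pg ->]] //; by exists g.
Qed.

Lemma card_graph : #|graph| = #|P|.
Proof. by apply: card_imset => r s [->]. Qed.

Local Notation T := (biset_twist phi).
Local Notation x0 := (twpair phi 1 1 : T).

Lemma twist_base (z : T) : exists a, z = biset_act T x0 a.
Proof.
elim/twistW: z => x y; exists (x^-1, y).
by rewrite /= /biset_act_fun /= twist_ractE twist_lactE invgK mulg1 mul1g.
Qed.

Lemma twist_stab : 'C[x0 | biset_act T] = graph.
Proof.
apply/setP=> -[g h]; rewrite !inE sub1set inE /= /biset_act_fun /=.
rewrite twist_ractE twist_lactE mulg1 mul1g.
apply/eqP/graphP=> [/twpairP[r Pr [er eh]]|[Pg ->]].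
  have eg : g = r^-1 by rewrite -[g]invgK er mul1g.
  rewrite eg groupV morphV //; split=> //.
  by apply: (mulgI (phi r)); rewrite -eh mulgV.
apply/twpairP; exists g^-1; rewrite ?groupV // mul1g morphV //; split=> //.
by rewrite mulVg.
Qed.

Lemma graph_group_set : group_set graph.
Proof. by rewrite -twist_stab groupP. Qed.
Canonical graph_group := Group graph_group_set.

(** The point [x0 a] has stabilizer [graph :^ a], and every point is of this
    form. *)
Lemma fixpts_twist (A : {set S * S}) a :
  (biset_act T x0 a \in fixpts T A) = (A \subset graph :^ a).
Proof.
by rewrite -twist_stab -astab1_act // /fixpts -sub1set astabC.
Qed.

Local Open Scope ring_scope.

Lemma mark_twist_neq0 (A : {set S * S}) :
  mark A (bcls T) != 0 -> exists a, A \subset (graph :^ a)%g.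
Proof.
rewrite mark_bcls eqz_nat cards_eq0 => /set0Pn[z].
by have [a ->] := twist_base z; rewrite fixpts_twist; exists a.
Qed.

(** The fixed points of [graph] are the points [x0 a] with [a] normalizing
    [graph], that is, the [N(graph)]-orbit of [x0]. *)
Lemma mark_twist_graph : mark graph (bcls T) *+ #|P| = #|'N(graph)%g|%:Z.
Proof.
have -> : mark graph (bcls T) = #|orbit (biset_act T) 'N(graph)%g x0|%:Z.
  rewrite mark_bcls; congr Posz; apply: eq_card => z.
  apply/idP/imsetP=> [|[a Na ->]]; last first.
    by rewrite fixpts_twist (normP Na).
  have [a ->] := twist_base z; rewrite fixpts_twist => sDa; exists a => //.
  by apply/normP/eqP; rewrite eq_sym eqEcard sDa cardJg leqnn.
rewrite -(card_orbit_stab (biset_act T) [group of 'N(graph)%g] x0).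
rewrite twist_stab (setIidPr (normG _)) card_graph.
by rewrite pmulrn mulrzz PoszM.
Qed.

Lemma card_twist : (#|T| * #|P| = #|S| * #|S|)%N.
Proof.
have eT : orbit (biset_act T) setT x0 = setT.
  apply/setP=> z; rewrite inE; have [a ->] := twist_base z.
  exact: mem_orbit.
rewrite -cardsT -eT -card_prod -[RHS]cardsT -card_graph -twist_stab.
by rewrite -(card_orbit_stab (biset_act T) [group of setT] x0) setTI.
Qed.

(** For such a predicate each point is counted exactly once on the left, for
    [D] its stabilizer: a [D] of order [|P|] fixes a point only if it is the
    stabilizer. *)
Lemma sum_mark_twist (pr : pred {group S * S}) :
  (forall D : {group S * S}, pr D -> #|D| = #|P|) ->
  (forall (D : {group S * S}) a, D = (graph :^ a)%g :> {set _} -> pr D) ->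
  \sum_(D : {group S * S} | pr D) mark D (bcls T) = #|T|%:Z.
Proof.
move=> prP prJ; under eq_bigr => D _ do rewrite mark_bcls.
rewrite -(big_morph Posz PoszD (erefl _)); congr Posz.
under eq_bigr => D _ do rewrite -sum1_card big_mkcond /=.
rewrite exchange_big /= -sum1_card; apply: eq_bigr => z _.
have [a ->] := twist_base z.
rewrite (bigD1 (graph_group :^ a)%G) ?(prJ _ a) //= fixpts_twist subxx.
rewrite big1 // => D /andP[prD neD].
rewrite fixpts_twist; case: ifP => // sD; case/eqP: neD; apply: val_inj.
apply/eqP; rewrite eqEcard; apply/andP; split; first exact: sD.
by rewrite /= cardJg card_graph (prP D).
Qed.

End TwistMarks.

Section Restriction.
Local Open Scope group_scope.
Variables (S : finGroupType) (P : {group S}) (phi : {morphism P >-> S}).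
Variable Y : biset S S.
Local Notation T := (biset_twist (on_subg_morphism phi)).

(** Composing [Y] with [[P, phi]_P^S] is restricting the left action on [Y]
    along [phi]. *)
Lemma card_fixpts_res (E : {set subg_of P * S}) :
  #|fixpts (biset_tens T Y) E| =
  #|fixpts Y [set (phi (sgval e.1), e.2) | e in E]|.
Proof.
pose f0 (z : T) (y : Y) : Y := bl (on_subg phi (repr z).1 * (repr z).2) y.
have f0E u t y : f0 (twpair (on_subg_morphism phi) u t) y = bl (on_subg phi u * t) y.
  rewrite /f0; have [r Rr [e1 e2]] := twist_repr (on_subg_morphism phi) u t.
  rewrite e2 {2}e1 morphM ?inE //.
  by rewrite mulgA.
have f0A z q y : f0 (br z q) y = f0 z (bl q y).
  by elim/twistW: z => u t /=; rewrite twist_ractE !f0E -lactM mulgA.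
have [f fE] := tens_lift f0A.
have fl g z : f (bl g z) = bl (phi (sgval g)) (f z).
  elim/tensW: z => z y; rewrite bl_tpair !fE; elim/twistW: z => u t /=.
  rewrite twist_lactE !f0E -lactM mulgA.
  by rewrite -[on_subg phi (g * u)]/(on_subg_morphism phi (g * u)) morphM ?inE.
have fr z h : f (br z h) = br (f z) h.
  elim/tensW: z => z y; rewrite br_tpair !fE; elim/twistW: z => u t /=.
  by rewrite !f0E lractA.
have norm z : z = tpair (twpair (on_subg_morphism phi) 1 1 : T) (f z).
  elim/tensW: z => z y; rewrite fE; elim/twistW: z => u t; rewrite f0E -tpairA /=.
  rewrite twist_ractE mul1g; congr (tpair _ y).
  by apply/twpairP; exists u; rewrite ?inE // mul1g.
have fI : injective f by move=> z z' e; rewrite (norm z) e -norm.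
rewrite -(card_imset _ fI); apply: eq_card => y.
apply/imsetP/fixptsP=> [[z /fixptsP fz ->] g h /imsetP[[u t] Et [-> ->]]|fy].
  by rewrite /= -fl (fz u t) // fr.
exists (tpair (twpair (on_subg_morphism phi) 1 1 : T) y); last first.
  by rewrite fE f0E mulg1 -[on_subg phi 1]/(on_subg_morphism phi 1) morph1 lact1.
apply/fixptsP=> u t Eut; apply: fI; rewrite fl fr fE f0E mulg1.
rewrite -[on_subg phi 1]/(on_subg_morphism phi 1) morph1 lact1.
by apply: fy; apply/imsetP; exists (u, t).
Qed.

End Restriction.

Section Transfer.
Local Open Scope group_scope.
Variables (S : finGroupType) (P : {group S}).

(** The biset that induces transfer from [P] to [S]. *)
Definition transfer_biset : biset S (subg_of P).
Proof.
exists S; exists (fun g s => g * s) (fun s u => s * sgval u).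
- exact: mul1g.
- by move=> g h s; rewrite mulgA.
- exact: mulg1.
- by move=> s u v; rewrite /= mulgA.
- by move=> g s u; rewrite mulgA.
Defined.

Lemma bifree_transfer : bifree_biset transfer_biset.
Proof.
split=> [g s /= e|s u /= e]; first by apply: (mulIg s); rewrite e mul1g.
by apply: val_inj; apply: (mulgI s); rewrite e mulg1.
Qed.

(** The map is [(s, (u, t)) |-> (s u, t)]. *)
Lemma transfer_res_iso (phi : {morphism P >-> S}) :
  biset_iso (biset_tens transfer_biset (biset_twist (on_subg_morphism phi)))
            (biset_twist phi).
Proof.
set T := biset_twist (on_subg_morphism phi).
pose f0 (s : transfer_biset) (z : T) : biset_twist phi :=
  twpair phi (s * sgval (repr z).1) (repr z).2.
have f0E s u t : f0 s (twpair (on_subg_morphism phi) u t) = twpair phi (s * sgval u) t.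
  rewrite /f0; have [r Rr [e1 e2]] := twist_repr (on_subg_morphism phi) u t.
  symmetry; apply/twpairP; exists (sgval r); first exact: subgP.
  by split; [rewrite {1}e1 /= mulgA | rewrite e2].
have f0A s q z : f0 (br s q) z = f0 s (bl q z).
  by elim/twistW: z => u t /=; rewrite twist_lactE !f0E /= mulgA.
have [f fE] := tens_lift f0A.
have norm z : exists s t, z = tpair (s : transfer_biset) (twpair (on_subg_morphism phi) 1 t : T).
  elim/tensW: z => s z; elim/twistW: z => u t.
  exists (s * sgval u), t; rewrite -[_ * _]/(br (s : transfer_biset) u) tpairA /=.
  by rewrite twist_lactE mulg1.
exists f; split.
- exists (fun z : biset_twist phi =>
    tpair ((repr z).1 : transfer_biset) (twpair (on_subg_morphism phi) 1 (repr z).2 : T)).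
    move=> z; have [s [t ->]] := norm z; rewrite fE f0E mulg1.
    have [r Pr [e1 e2]] := twist_repr phi s t.
    have -> : tpair (s : transfer_biset) (twpair (on_subg_morphism phi) 1 t : T) =
       tpair (br ((repr (twpair phi s t)).1 : transfer_biset) (subg P r))
             (twpair (on_subg_morphism phi) 1 t : T).
      by rewrite {1}e1 /= subgK.
    rewrite tpairA /= twist_lactE mulg1 e2; congr (tpair _ _).
    symmetry; apply/twpairP; exists (subg P r); rewrite ?inE // mul1g; split=> //.
    by rewrite /= /on_subg subgK.
  by elim/twistW=> s t; rewrite fE f0E mulg1 /twpair -surjective_pairing reprK.
- move=> g; elim/tensW=> s; elim/twistW=> u t; rewrite bl_tpair !fE !f0E /=.
  by rewrite twist_lactE mulgA.
elim/tensW=> s; elim/twistW=> u t h; rewrite br_tpair fE /= twist_ractE !fE !f0E.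
by rewrite twist_ractE.
Qed.

(** Restricting to [P] and inducing back is multiplication by the [S]-set
    [S / P]: send [((s, t), x)] to [(s P, s t x)].  The left coset [s P] is
    encoded by the right coset [P s^-1], on which [S] acts by ['Rs]. *)
Lemma card_fixpts_transfer_res (X : biset S S) (E : {set S * S}) :
  #|fixpts (biset_tens (biset_twist (idm_morphism P)) X) E| =
  (#|'Fix_(rcosets P [set: S] | 'Rs)([set e.1 | e in E])%act| * #|fixpts X E|)%N.
Proof.
set T := biset_twist (idm_morphism P).
pose f0 (z : T) (x : X) : {set S} * X :=
  (P :* (repr z).1^-1, bl ((repr z).1 * (repr z).2) x).
have f0E s t x : f0 (twpair (idm_morphism P) s t) x = (P :* s^-1, bl (s * t) x).
  rewrite /f0; have [r Pr [e1 e2]] := twist_repr (idm_morphism P) s t.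
  rewrite e2 [in RHS]e1 -[idm_morphism P r]/r; congr (_, _); last by rewrite mulgA.
  by rewrite invMg rcosetM (@rcoset_id _ P r^-1) ?groupV.
have f0A z q x : f0 (br z q) x = f0 z (bl q x).
  by elim/twistW: z => s t /=; rewrite twist_ractE !f0E -lactM mulgA.
have [f fE] := tens_lift f0A.
have norm (z : biset_tens T X) : exists s x, z = tpair (twpair (idm_morphism P) s 1 : T) x.
  elim/tensW: z => z x; elim/twistW: z => s t; exists s, (bl t x).
  by rewrite -tpairA /= twist_ractE mul1g.
have fn s x : f (tpair (twpair (idm_morphism P) s 1 : T) x) = (P :* s^-1, bl s x).
  by rewrite fE f0E mulg1.
have fl g z : f (bl g z) = ((f z).1 :* g^-1, bl g (f z).2).
  have [s [x ->]] := norm z; rewrite bl_tpair /= twist_lactE !fn /=.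
  by rewrite invMg rcosetM lactM.
have fr z h : f (br z h) = ((f z).1, br (f z).2 h).
  by have [s [x ->]] := norm z; rewrite br_tpair !fn /= lractA.
have fI : injective f.
  move=> z z'; have [s [x ->]] := norm z; have [s' [x' ->]] := norm z'.
  rewrite !fn => -[eP ex].
  have Pr : s^-1 * s' \in P.
    by rewrite -[s']invgK -mem_rcoset -eP rcoset_refl.
  have es : s' = s * (s^-1 * s') by rewrite mulKVg.
  have -> : x = bl (s^-1 * s') x' by rewrite lactM -ex -lactM mulVg lact1.
  rewrite -tpairA /= twist_ractE mul1g; congr (tpair _ _).
  apply/twpairP; exists (s^-1 * s')^-1; rewrite ?groupV //.
  by rewrite -[idm_morphism P _]/(_^-1) mulVg invMg invgK mulKVg.
rewrite -cardsX -(card_imset _ fI); apply: eq_card => -[C x].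
apply/imsetP/idP=> [[z /fixptsP fz eC]|].
  apply/setXP; split; last first.
    by apply/fixptsP=> g h Egh; have := fz g h Egh => /(congr1 f); rewrite fl fr -eC => -[].
  apply/setIP; split.
    have [s [y ez]] := norm z; rewrite ez fn in eC; case: eC => -> _.
    by apply/imsetP; exists s^-1; rewrite ?inE // rcosetE.
  apply/afixP=> _ /imsetP[[g h] Egh ->] /=.
  have := fz g h Egh => /(congr1 f); rewrite fl fr -eC => -[/= eCg _].
  by rewrite rcosetE -{1}eCg -rcosetM mulVg rcoset1.
case/setXP=> /setIP[/imsetP[s _ ->] /afixP fC] /fixptsP fx.
rewrite rcosetE in fC *.
have [y ey] : exists y : X, bl s^-1 y = x by exists (bl s x); rewrite -lactM mulVg lact1.
exists (tpair (twpair (idm_morphism P) s^-1 1 : T) y); last by rewrite fn invgK ey.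
apply/fixptsP=> g h Egh; apply: fI; rewrite fl fr fn invgK ey /= (fx g h Egh).
congr (_, _); have /fC /= : g \in [set e.1 | e in E] by apply/imsetP; exists (g, h).
by rewrite rcosetE => e; rewrite -[in LHS]e rcosetK.
Qed.

End Transfer.

(** * Fusion maps and twisted diagonals *)

Section FusionMaps.
Local Open Scope group_scope.
Variables (S : finGroupType) (F : fusion_system S).
Implicit Types (P Q : {group S}) (f g : S -> S).

(** Membership in [F(P, S)] for plain functions, which compose and invert
    without any change of domain. *)
Definition fhom P f : Prop :=
  exists2 phi : {morphism P >-> S}, F P [set: S]%G phi & {in P, phi =1 f}.

Lemma fhom_eq P f g : {in P, f =1 g} -> fhom P f -> fhom P g.
Proof.
by move=> efg [phi Fphi e]; exists phi => // x Px; rewrite e // efg.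
Qed.

Lemma fhomM P f : fhom P f -> {in P &, {morph f : x y / x * y}}.
Proof.
by move=> [phi _ e] x y Px Py; rewrite -!e ?groupM // morphM.
Qed.

Lemma fhom_inj P f : fhom P f -> {in P &, injective f}.
Proof.
move=> [phi /fus_injm/injmP inj e] x y Px Py.
by rewrite -!e //; apply: inj.
Qed.

Lemma fus_id P Q : P \subset Q -> F P Q (idm_morphism P).
Proof.
move=> sPQ; apply: (@fus_eq _ F _ _ (conjgm_morphism P 1)).
  by move=> x _; apply: conjg1.
by apply: fus_conj; rewrite conjsg1.
Qed.

Lemma fus_fhom P Q (phi : {morphism P >-> S}) : F P Q phi -> fhom P phi.
Proof.
move=> Fphi; exists phi => //.
by apply: (fus_comp Fphi (fus_id (subsetT Q))).
Qed.

Lemma fhom_conj P a : fhom P (conjg^~ a).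
Proof. by exists (conjgm_morphism P a) => //; apply/fus_conj/subsetT. Qed.

Lemma fhom_sub P Q f : Q \subset P -> fhom P f -> fhom Q f.
Proof.
move=> sQP [phi Fphi e]; exists (restrm_morphism sQP phi).
  exact: (fus_comp (fus_id sQP) Fphi).
by move=> x Qx; apply: e; apply: subsetP Qx.
Qed.

Lemma fhom_im P Q f : fhom P f -> {in P, forall x, f x \in Q} ->
  exists2 phi : {morphism P >-> S}, F P Q phi & {in P, phi =1 f}.
Proof.
move=> [phi Fphi e] fQ; exists phi => //.
have sQ : phi @* P \subset Q.
  by apply/subsetP=> _ /morphimP[x _ Px ->]; rewrite e // fQ.
exact: (fus_comp (fus_corestr Fphi) (fus_id sQ)).
Qed.

Lemma fhom_comp P Q f g : fhom P f -> fhom Q g -> {in P, forall x, f x \in Q} ->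
  fhom P (g \o f).
Proof.
move=> Ff [psi Fpsi eg] fQ; have [phi Fphi ef] := fhom_im Ff fQ.
have hM : {in P &, {morph (g \o f) : x y / x * y}}.
  move=> x y Px Py; rewrite /= -!ef ?groupM // morphM // -!eg ?groupM ?ef ?fQ //.
  by rewrite morphM ?fQ.
exists (Morphism hM) => //; apply: (fus_comp Fphi Fpsi) => x Px.
by rewrite /= ef // eg // fQ.
Qed.

Lemma fhom_inv P Q f : fhom P f -> Q = f @: P :> {set S} ->
  exists2 g, fhom Q g & {in P, cancel f g}.
Proof.
move=> [phi Fphi e] eQ; have inj := fus_injm Fphi.
have eQ' : Q = (phi @* P)%G.
  by apply: val_inj; rewrite /= morphimEdom eQ; apply: eq_in_imset => x /e.
rewrite eQ'; exists (invm inj); first exact: (fus_fhom (fus_inv inj Fphi)).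
by move=> x Px; rewrite -e // invmE.
Qed.

End FusionMaps.

Section TwistedImages.
Local Open Scope group_scope.
Variables (S : finGroupType) (F : fusion_system S).
Implicit Types (P Q : {group S}) (D E : {group S * S}) (f g : S -> S).

Definition fst_group D : {group S} := (fst_morphism S S @* D)%G.

Lemma fst_groupP D x : reflect (exists y, (x, y) \in D) (x \in fst_group D).
Proof.
apply: (iffP idP) => [/morphimP[[x' y] _ Dxy ->]|[y Dxy]]; first by exists y.
by apply/morphimP; exists (x, y); rewrite ?inE.
Qed.

Lemma fst_group1 D d : d \in D -> d.1 \in fst_group D.
Proof. by case: d => x y Dxy; apply/fst_groupP; exists y. Qed.

Definition twisted_image f h (D : {set S * S}) : {set S * S} := [set (f d.1, d.2 ^ h) | d in D].

Lemma twisted_imageP f h (D : {set S * S}) x y :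
  reflect (exists2 d, d \in D & x = f d.1 /\ y = d.2 ^ h) ((x, y) \in twisted_image f h D).
Proof.
by apply: (iffP imsetP) => -[d Dd] => [[-> ->]|[-> ->]]; exists d.
Qed.

Section Hom.
Variables (f : S -> S) (h : S) (D : {group S * S}).
Hypothesis Ff : fhom F (fst_group D) f.

Lemma twisted_image_morphM : {in D &, {morph (fun d => (f d.1, d.2 ^ h)) : x y / x * y}}.
Proof.
move=> x y Dx Dy; rewrite (fhomM Ff) ?fst_group1 // conjMg; exact: erefl.
Qed.
Definition twisted_image_morphism : {morphism D >-> S * S} := Morphism twisted_image_morphM.

Lemma twisted_image_inj : {in D &, injective (fun d => (f d.1, d.2 ^ h))}.
Proof.
move=> [x y] [x' y'] Dx Dy /= [e1 /conjg_inj ->].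
by rewrite (fhom_inj Ff _ _ e1) //; apply: fst_group1 Dx || apply: fst_group1 Dy.
Qed.

Lemma injm_twisted_image : 'injm twisted_image_morphism.
Proof. by apply/injmP=> x y Dx Dy; apply: twisted_image_inj. Qed.

Lemma twisted_imageE : twisted_image f h D = twisted_image_morphism @* D.
Proof. by rewrite morphimEdom. Qed.

Lemma twisted_image_group_set : group_set (twisted_image f h D).
Proof. by rewrite twisted_imageE groupP. Qed.

Lemma card_twisted_image : #|twisted_image f h D| = #|D|.
Proof. by rewrite twisted_imageE card_injm ?injm_twisted_image. Qed.

End Hom.

(** Conjugacy in the product of [F], on the left factor, and of the fusion
    system of [S], on the right factor. *)
Definition tconj D E : Prop :=
  exists f h, fhom F (fst_group D) f /\ E = twisted_image f h D :> {set S * S}.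

Lemma fst_group_twisted_image f h D E : E = twisted_image f h D :> {set S * S} ->
  fst_group E = f @: fst_group D :> {set S}.
Proof.
move=> eE; apply/setP=> x; apply/fst_groupP/imsetP=> [[y]|[x' /fst_groupP[y Dy] ->]].
  by rewrite eE => /twisted_imageP[[x' y'] Dd [-> _]]; exists x' => //; apply: fst_group1 Dd.
by exists (y ^ h); rewrite eE; apply/twisted_imageP; exists (x', y).
Qed.

Lemma card_tconj D E : tconj D E -> #|E| = #|D|.
Proof. by move=> [f [h [Ff ->]]]; rewrite (card_twisted_image h Ff). Qed.

Lemma tconj_conj D E a : E = D :^ a :> {set S * S} -> tconj D E.
Proof.
move=> eE; exists (conjg^~ a.1), a.2; split; first exact: fhom_conj.
by rewrite eE.
Qed.

Lemma tconj_sym D E : tconj D E -> tconj E D.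
Proof.
move=> [f [h [Ff eE]]].
have [g Fg fK] := fhom_inv Ff (fst_group_twisted_image eE).
exists g, h^-1; split=> //; apply/setP=> -[x y]; apply/idP/twisted_imageP=> [Dxy|].
  exists (f x, y ^ h); first by rewrite eE; apply/twisted_imageP; exists (x, y).
  by rewrite /= conjgK fK //; apply: fst_group1 Dxy.
move=> [[x' y']]; rewrite eE => /twisted_imageP[[u v] Duv [-> ->]] /= [-> ->].
by rewrite conjgK fK //; apply: fst_group1 Duv.
Qed.

Lemma tconj_trans E D D' : tconj D E -> tconj E D' -> tconj D D'.
Proof.
move=> [f [h [Ff eE]]] [g [k [Fg eD']]]; exists (g \o f), (h * k); split.
  by apply: (fhom_comp Ff Fg) => x Dx; rewrite (fst_group_twisted_image eE); apply: imset_f.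
rewrite eD' eE /twisted_image -imset_comp; apply: eq_imset => d /=.
by rewrite conjgM.
Qed.

(** The graphs of the morphisms of [F], which are the point stabilizers in the
    bisets [[P, phi]_S^S]. *)
Definition fdiag D : Prop :=
  exists2 f, fhom F (fst_group D) f & D = [set (r, f r) | r in fst_group D] :> {set S * S}.

Lemma fdiag_graph P (phi : {morphism P >-> S}) : F P [set: S]%G phi ->
  fdiag (graph_group phi).
Proof.
move=> Fphi; have eP : fst_group (graph_group phi) = P.
  apply/val_inj/setP=> x; apply/fst_groupP/idP=> [[y /graphP[]]|Px] //.
  by exists (phi x); apply/graphP.
by exists phi; rewrite eP //; apply: fus_fhom Fphi.
Qed.

Lemma fdiag_sub D E : E \subset D -> fdiag D -> fdiag E.
Proof.
move=> sED [f Ff eD]; exists f.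
  by apply: fhom_sub Ff; apply: morphimS.
have sub x y : (x, y) \in E -> y = f x.
  by move=> /(subsetP sED); rewrite eD => /imsetP[r _ [-> ->]].
apply/setP=> -[x y]; apply/idP/imsetP=> [Exy|[r /fst_groupP[z Erz] [-> ->]]].
  by exists x; rewrite -?(sub _ _ Exy) //; apply: fst_group1 Exy.
by rewrite -(sub _ _ Erz).
Qed.

Lemma fdiag_tconj D E : tconj D E -> fdiag D -> fdiag E.
Proof.
move=> rDE; have [g [k [Fg eD]]] := tconj_sym rDE => -[f Ff eDf].
have gD x : x \in fst_group E -> g x \in fst_group D.
  by move=> Ex; rewrite (fst_group_twisted_image eD); apply: imset_f.
exists (conjg^~ k^-1 \o (f \o g)).
  apply: (@fhom_comp _ F _ [set: S]%G); first exact: fhom_comp Fg Ff gD.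
    exact: fhom_conj.
  by move=> x _; rewrite inE.
have sub x y : (x, y) \in E -> y = f (g x) ^ k^-1.
  move=> Exy; have : (g x, y ^ k) \in D by rewrite eD; apply/twisted_imageP; exists (x, y).
  by rewrite eDf => /imsetP[r _ [-> <-]]; rewrite conjgK.
apply/setP=> -[x y]; apply/idP/imsetP=> [Exy|[r /fst_groupP[z Erz] [-> ->]]].
  by exists x; rewrite /= -?(sub _ _ Exy) //; apply: fst_group1 Exy.
by rewrite /= -(sub _ _ Erz).
Qed.

End TwistedImages.

(** * Consequences of saturation *)

Section Saturation.
Local Open Scope group_scope.
Variables (S : finGroupType) (F : fusion_system S) (p : nat).
Hypotheses (pS : p.-group [set: S]) (satF : saturated F p).
Implicit Types (P Q : {group S}) (D E : {group S * S}) (f g : S -> S).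

Lemma fus_isoP P Q :
  fus_iso F P Q <-> exists2 f, fhom F P f & Q = f @: P :> {set S}.
Proof.
split=> [[phi [psi [Fphi Fpsi phiK psiK]]]|[f Ff eQ]].
  exists phi; first exact: fus_fhom Fphi.
  apply/setP=> y; apply/idP/imsetP=> [Qy|[x Px ->]].
    exists (psi y); last by rewrite psiK.
    by apply: (subsetP (fus_im Fpsi)); apply: mem_morphim.
  by apply: (subsetP (fus_im Fphi)); apply: mem_morphim.
have [g Fg fK] := fhom_inv Ff eQ.
have [|phi Fphi ef] := @fhom_im _ F P Q f Ff.
  by move=> x Px; rewrite eQ imset_f.
have gP : {in Q, forall y, g y \in P}.
  by move=> y; rewrite eQ => /imsetP[x Px ->]; rewrite fK.
have [psi Fpsi eg] := fhom_im Fg gP.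
exists phi, psi; split=> // [x Px|y Qy].
  by rewrite ef // eg ?fK // eQ imset_f.
rewrite eg // ef ?gP //; move: Qy; rewrite eQ => /imsetP[x Px ->].
by rewrite fK.
Qed.

Lemma fus_iso_refl P : fus_iso F P P.
Proof.
apply/fus_isoP; exists id; last by rewrite imset_id.
exact: fus_fhom (fus_id F (subxx P)).
Qed.

Lemma fus_iso_trans P Q R : fus_iso F P Q -> fus_iso F Q R -> fus_iso F P R.
Proof.
move=> /fus_isoP[f Ff eQ] /fus_isoP[g Fg eR]; apply/fus_isoP.
exists (g \o f); last by rewrite imset_comp -eQ.
by apply: fhom_comp Ff Fg _ => x Px; rewrite eQ imset_f.
Qed.

Lemma ex_fully_normalized Q : exists2 P, fus_iso F Q P & fully_normalized F P.
Proof.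
pose isoQ P := `[< fus_iso F Q P >].
have Q0 : isoQ Q by apply/asboolP/fus_iso_refl.
have [P /asboolP QP maxP] := arg_maxnP (fun P : {group S} => #|'N(P)|) Q0.
exists P => // P' PP'; apply: maxP; apply/asboolP; exact: fus_iso_trans QP PP'.
Qed.

(** Take [P] fully normalized.  For any isomorphism [phi : Q -> P] in [F] the
    [p]-group [phi Aut_S(Q) phi^-1] can be moved into the Sylow subgroup
    [Aut_S(P)] by some [x] in [Aut_F(P)]; then [eta = x phi] turns conjugation
    by elements of [N(Q)] into conjugation by elements of [N(P)]. *)
Lemma ex_receptive_iso Q : exists P eta,
  [/\ fhom F Q eta, P = eta @: Q :> {set S}, fully_centralized F P
    & {in 'N(Q), forall y, exists2 z, z \in 'N(P) &
         {in Q, forall q, eta (q ^ y) = eta q ^ z}}].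
Proof.
have [P /fus_isoP[f0 Ff0 eP] fnP] := ex_fully_normalized Q.
have [fcP sylP] := satF.1 P fnP.
have [phi Fphi ef0] := Ff0; have inj := fus_injm Fphi.
have eP' : P = (phi @* Q)%G.
  by apply/val_inj; rewrite /= eP morphimEdom; apply: eq_in_imset => x /ef0.
have Fphi' := fus_fhom Fphi.
have [g Fg phiK] : exists2 g, fhom F P g & {in Q, cancel phi g}.
  by apply: fhom_inv Fphi' _; rewrite eP'/= morphimEdom.
(* [b y] is conjugation by [y], carried to [P] along [phi] *)
pose b y := Aut_isom inj (subxx Q) (conj_aut Q y).
have Qaut y : y \in 'N(Q) -> conj_aut Q y \in Aut Q.
  by move=> Ny; apply: (subsetP (Aut_conj_aut _ 'N(Q))); apply: mem_morphim.
have bE y q : y \in 'N(Q) -> q \in Q -> b y (phi q) = phi (q ^ y).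
  by move=> Ny Qq; rewrite /b Aut_isomE ?Qaut // norm_conj_autE.
pose A := (Aut_isom_morphism inj (subxx Q) @* (conj_aut Q @* 'N(Q)))%G.
have pA : p.-group A by rewrite !morphim_pgroup // (pgroupS (subsetT _)).
have sA : A \subset Aut_fus F P.
  apply/subsetP=> _ /morphimP[_ _ /morphimP[y _ Ny ->] ->].
  rewrite inE; apply/andP; split.
    by rewrite {1}eP' /=; apply: Aut_Aut_isom.
  apply/asboolP; apply: (@fhom_im _ F).
    apply: (@fhom_eq _ _ _ (phi \o (conjg^~ y \o g))).
      move=> x; rewrite {1}eP' => /morphimP[q _ Qq ->].
      by rewrite /= phiK // -bE.
    apply: fhom_comp Fphi' _; last first.
      by move=> x; rewrite {1}eP' => /morphimP[q _ Qq ->]; rewrite /= phiK // memJ_norm.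
    apply: (fhom_comp Fg (@fhom_conj _ F Q y)) => x.
    by rewrite {1}eP' => /morphimP[q _ Qq ->]; rewrite phiK.
  move=> x; rewrite {1}eP' => /morphimP[q _ Qq ->].
  by rewrite -[X in X \in _]/(b y (phi q)) bE // eP' mem_morphim ?memJ_norm.
have [x Fx sAx] := Sylow_Jsub sylP sA pA.
move: (Fx); rewrite inE => /andP[Ax /asboolP[chi Fchi echi]].
have phiP q : q \in Q -> phi q \in P by move=> Qq; rewrite eP' mem_morphim.
exists P, (x \o phi); split=> //.
- apply: (fhom_comp Fphi' _ phiP); apply: fhom_eq echi _; exact: fus_fhom Fchi.
- rewrite imset_comp -morphimEdom -[_ @* _]/(gval (phi @* Q)%G) -eP'.
  by have := im_autm Ax; rewrite morphimEdom => /esym.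
move=> y Ny; have: b y ^ x \in Aut_S P.
  apply: (subsetP sAx); rewrite memJ_conjg; apply: mem_morphim; first exact: Qaut.
  exact: mem_morphim.
case/morphimP=> z _ Nz ez; exists z => // q Qq /=.
rewrite -(norm_conj_autE Nz) ?Aut_closed ?phiP // -ez conjgE !permM permK.
by rewrite bE.
Qed.

(** Every member [D1] of the class of [D0] is carried to [D0] by a morphism
    that is defined on its whole normalizer. *)
Definition receptive D0 : Prop := forall D1, tconj F D0 D1 ->
  exists f h, fhom F (fst_group 'N(D1)) f /\ D0 = twisted_image f h D1 :> {set S * S}.

(** Let [D] be the graph of [phi : P -> Q] and [eta : Q -> P0] be given by
    [ex_receptive_iso].  The reference is [D0 = {(eta q, q) | q in Q}].  If
    [D1] is obtained from it by [f] on the left and [h] on the right, the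
    morphism to extend is [theta = f^-1] on [f P0].  An element [(x, y)] of
    [N(D1)] makes conjugation by [x] on [f P0] correspond to conjugation by
    [h y h^-1] on [Q], and so, by the choice of [eta], to conjugation by an
    element of [N(P0)]: thus [x] lies in the extender of [theta], whose image
    [P0] is fully centralized. *)
Lemma ex_receptive D : fdiag F D -> exists2 D0, tconj F D D0 & receptive D0.
Proof.
move=> [phi Fphi eD].
have sndD_set : group_set (phi @: fst_group D).
  have [psi _ e] := Fphi; rewrite -(eq_in_imset e) -morphimEdom; exact: groupP.
pose Q := Group sndD_set.
have phiQ : {in fst_group D, forall x, phi x \in Q} by move=> x Px; apply: imset_f.
have [P0 [eta [Feta eP0 fcP0 etaJ]]] := ex_receptive_iso Q.
have Ff0 := fhom_comp Fphi Feta phiQ.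
pose D0 := Group (twisted_image_group_set 1 Ff0).
exists D0; first by exists (eta \o phi), 1.
have D0P x y : (x, y) \in D0 -> y \in Q /\ x = eta y.
  case/twisted_imageP=> -[r s]; rewrite eD => /imsetP[r' Pr' [-> ->]] [-> ->].
  by rewrite /= conjg1 phiQ.
have QD0 q : q \in Q -> (eta q, q) \in D0.
  case/imsetP=> r Pr ->; apply/twisted_imageP; exists (r, phi r); last by rewrite /= conjg1.
  by rewrite eD imset_f.
move=> D1 [f [h [Ff eD1]]].
have [g Fg fK] := fhom_inv Ff (fst_group_twisted_image eD1).
have etaD0 q : q \in Q -> eta q \in fst_group D0 by move=> Qq; apply: fst_group1 (QD0 _ Qq).
have D1P x y : (x, y) \in D1 -> exists2 q, q \in Q & x = f (eta q) /\ y = q ^ h.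
  rewrite eD1 => /twisted_imageP[[u v] /D0P[Qv ->] [-> ->]]; by exists v.
have QD1 q : q \in Q -> (f (eta q), q ^ h) \in D1.
  by move=> Qq; rewrite eD1; apply/twisted_imageP; exists (eta q, q); first exact: QD0.
have [theta Ftheta etheta] := Fg.
have imtheta : (theta @* fst_group D1)%G = P0.
  apply/val_inj/setP=> x; rewrite /= eP0; apply/morphimP/imsetP.
    move=> [u _ /fst_groupP[v /D1P[q Qq [-> ev]]] ->]; exists q => //.
    by rewrite etheta ?fK ?etaD0 //; apply: fst_group1 (QD1 _ Qq).
  move=> [q Qq ->]; have P1q := fst_group1 (QD1 _ Qq).
  by exists (f (eta q)); rewrite ?etheta ?fK ?etaD0.
have [|psi Fpsi epsi] := satF.2 _ theta Ftheta; first by rewrite imtheta.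
exists psi, h^-1; split.
  apply: fhom_sub (fus_fhom Fpsi); apply/subsetP=> x /fst_groupP[y /normP Nxy].
  have HN q : q \in Q -> exists2 q', q' \in Q &
      f (eta q) ^ x = f (eta q') /\ q ^ (h * y) = q' ^ h.
    move=> Qq; have := QD1 _ Qq; rewrite -(memJ_conjg _ (x, y)) Nxy.
    by case/D1P=> q' Qq' [e1 e2]; exists q'; rewrite // conjgM.
  have Ny : h * y * h^-1 \in 'N(Q).
    rewrite inE; apply/subsetP=> _ /imsetP[q Qq ->].
    by have [q' Qq' [_ e]] := HN q Qq; rewrite conjgM e conjgK.
  have [z Nz zE] := etaJ _ Ny.
  rewrite inE; apply/andP; split.
    rewrite inE; apply/subsetP=> _ /imsetP[u /fst_groupP[v /D1P[q Qq [-> _]]] ->].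
    by have [q' Qq' [-> _]] := HN q Qq; apply: fst_group1 (QD1 _ Qq').
  apply/exists_inP; exists z; first by rewrite -[_ @* _]/(gval (theta @* _)%G) imtheta.
  apply/forall_inP=> u /fst_groupP[v /D1P[q Qq [-> _]]].
  have [q' Qq' [e1 e2]] := HN q Qq.
  have P1 r : r \in Q -> f (eta r) \in fst_group D1 by move=> Qr; apply: fst_group1 (QD1 _ Qr).
  rewrite e1 !etheta ?P1 // !fK ?etaD0 // -zE //.
  by rewrite [q ^ _]conjgM e2 conjgK.
have psiE q : q \in Q -> psi (f (eta q)) = eta q.
  move=> Qq; have P1q := fst_group1 (QD1 _ Qq).
  by rewrite epsi // etheta // fK ?etaD0.
apply/setP=> -[x y]; apply/idP/twisted_imageP=> [/D0P[Qy ->]|[[u v] /D1P[q Qq [-> ->]]]].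
  by exists (f (eta y), y ^ h); rewrite ?QD1 //= psiE ?conjgK.
by rewrite /= psiE // conjgK => -[-> ->]; apply: QD0.
Qed.

End Saturation.

(** * The characteristic element *)

Section CharacteristicElement.
Variables (S : finGroupType) (F : fusion_system S) (p : nat).
Hypotheses (p_pr : prime p) (pS : (p.-group [set: S])%g) (satF : saturated F p).
Implicit Types (P Q : {group S}) (D E : {group S * S}).

Local Notation A := (burnside S S).

(** [Omega] and [U] are built simultaneously, as the two components of an
    element of [A(S, S) ^ 2]; the predicate [K] restricts the orders of the
    subgroups [P]. *)
Definition basic_pair (K : nat -> Prop) (v : A * A) : Prop :=
  exists (P : {group S}) (phi : {morphism P >-> S}),
    [/\ K #|P|, F P [set: S]%G phi
      & v = (bcls (biset_twist phi), bcls (biset_twist (idm_morphism P)))].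

Definition pair_span K := zspan (basic_pair K).

Lemma span_sub K K' v : (forall k, K k -> K' k) -> v \in pair_span K -> v \in pair_span K'.
Proof.
move=> KK'; move: v; apply: zspan_ind => [|u v uK vK|v [P [phi [KP Fphi ->]]]].
- exact: rpred0.
- exact: rpredB.
by apply: mem_zspan; exists P, phi; split=> //; apply: KK'.
Qed.

Lemma mark_span_fdiag K v E : v \in pair_span K -> ~ fdiag F E -> mark E v.1 = 0.
Proof.
move=> vK nE; move: v vK.
apply: zspan_ind => [|u v eu ev|_ [P [phi [KP Fphi ->]]]]; first exact: mark0.
  by rewrite markB eu ev subrr.
apply/eqP/negP=> /negP/mark_twist_neq0[a sEa]; apply: nE.
apply: (fdiag_sub (D := (graph_group phi :^ a)%G)) => //.
by apply: (fdiag_tconj _ (fdiag_graph Fphi)); apply: (@tconj_conj _ _ _ _ a).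
Qed.

Lemma mark_span_gt k v E : v \in pair_span (eq k) -> (k < #|E|)%N -> mark E v.1 = 0.
Proof.
move=> vK kE; move: v vK.
apply: zspan_ind => [|u v eu ev|_ [P [phi [kP Fphi ->]]]]; first exact: mark0.
  by rewrite markB eu ev subrr.
apply/eqP/negP=> /negP/mark_twist_neq0[a /subset_leq_card].
by rewrite cardJg card_graph -kP leqNgt kE.
Qed.

Lemma mark1_bcls (P Q : finGroupType) (X : biset P Q) : mark 1%g (bcls X) = #|X|%:Z.
Proof.
rewrite mark_bcls; congr Posz; apply: eq_card => x.
by rewrite [RHS]inE; apply/fixptsP=> g h /set1P[-> ->]; rewrite lact1 ract1.
Qed.

(** The degree of [[P, phi]_S^S] is [|S : P|], which [p] divides for [P < S]. *)
Lemma degree_span_lt k v : v \in pair_span (eq k) -> (k < #|S|)%N ->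
  exists m : int, mark 1%g v.1 = m *+ (p * #|S|).
Proof.
move=> vK kS; move: v vK.
apply: zspan_ind => [|u v [m em] [n en]|_ [P [phi [kP Fphi ->]]]].
- by exists 0; rewrite mark0 mul0rn.
- by exists (m - n); rewrite markB em en mulrnBl.
have pdvd : (p %| #|[set: S] : P|%g)%N.
  have : (p.-nat #|[set: S] : P|%g)%N by apply: pnat_dvd pS; apply: dvdn_indexg.
  case/p_natP=> -[|j] ej; last by rewrite ej expnS dvdn_mulr.
  have := Lagrange (subsetT P); rewrite ej cardsT muln1 => eP.
  by move: kS; rewrite kP eP ltnn.
have [j ej] := dvdnP pdvd.
exists j%:Z; rewrite mark1_bcls /= pmulrn mulrzz -PoszM; congr Posz.
have eS : #|S| = (#|P| * (j * p))%N by rewrite -ej Lagrange ?subsetT ?cardsT.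
apply/eqP; rewrite -(eqn_pmul2r (cardG_gt0 P)) card_twist {1}eS.
by rewrite -mulnA mulnC !mulnA.
Qed.

(** The points of [[S, alpha]_S^S] have stabilizers of order [|S|]; count them
    by stabilizer. *)
Lemma degree_span_top v : v \in pair_span (eq #|S|) ->
  mark 1%g v.1 = \sum_(D : {group S * S} | `[< fdiag F D >] && (#|D| == #|S|)) mark D v.1.
Proof.
move: v; apply: zspan_ind => [|u v eu ev|_ [P [phi [kP Fphi ->]]]].
- by rewrite mark0 big1 // => D _; rewrite mark0.
- by rewrite markB eu ev -sumrB; apply: eq_bigr => D _; rewrite markB.
rewrite mark1_bcls /= -(sum_mark_twist (phi := phi) (pr := fun D =>
   `[< fdiag F D >] && (#|D| == #|S|))) //.
  by move=> D /andP[_ /eqP->].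
move=> D a eD; have t := @tconj_conj _ F _ _ _ eD.
rewrite (card_tconj t) /= card_graph -kP eqxx andbT; apply/asboolP.
exact: fdiag_tconj t (fdiag_graph Fphi).
Qed.

(** The operator [x |-> x o [P, incl]] multiplies the mark at [E] by the number
    of points of [S / P] fixed by the left projection of [E]; as [S] is a
    [p]-group this is congruent to [|S / P|] modulo [p]. *)
Lemma span_multipliers K v : v \in pair_span K -> exists n : {set S} -> int,
  [/\ forall x (E : {set S * S}), mark E (bcomp x v.2) = n [set e.1 | e in E] * mark E x,
      forall Q : {group S}, (p%:Z %| n Q - n 1%g)%Z
    & n 1%g *+ #|S| = mark 1%g v.1].
Proof.
move: v; apply: zspan_ind.
- exists (fun _ => 0); split=> [x E|Q|]; last by rewrite mark0 mul0rn.
    by rewrite -[(0 : A * A).2]/(0 : A) -[0](subrr 0) bcompBr subrr mark0 mul0r.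
  by rewrite subrr dvdz0.
- move=> u v [n [nx np n1]] [m [mx mp m1]]; exists (fun B : {set S} => n B - m B); split.
  + by move=> x E; rewrite /= bcompBr markB nx mx mulrBl.
  + by move=> Q; rewrite opprD addrACA -opprD rpredB.
  by rewrite markB mulrnBl n1 m1.
move=> _ [P [phi [kP Fphi ->]]].
exists (fun B : {set S} => #|('Fix_(rcosets P [set: S] | 'Rs)(B))%g|%:Z); split.
- move=> x E; elim/burnside_ind: x => [X|x y Hx Hy].
    by rewrite bcompE !mark_bcls card_fixpts_transfer_res PoszM.
  by rewrite bcompBl !markB Hx Hy -mulrBr.
- move=> Q.
  have aP (B : {set S}) : [acts B, on rcosets P [set: S] | 'Rs]%g.
    apply/actsP=> a _ C; apply/imsetP/imsetP=> -[b _ e].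
      exists (b * a^-1)%g; rewrite ?inE //; move: e; rewrite /= !rcosetE => e.
      by rewrite rcosetM -e rcosetK.
    by exists (b * a)%g; rewrite ?inE // e /= !rcosetE rcosetM.
  have H (R : {group S}) : (p%:Z %| #|rcosets P [set: S]|%:Z -
      #|('Fix_(rcosets P [set: S] | 'Rs)(R))%g|%:Z)%Z.
    rewrite -eqz_mod_dvd !modz_nat eqz_nat.
    by rewrite (pgroup_fix_mod (pgroupS (subsetT R) pS) (aP R)).
  have e (a b c : int) : a - b = (c - b) - (c - a).
    by rewrite opprB [RHS]addrC addrA subrK.
  rewrite (e _ _ #|rcosets P [set: S]|%:Z).
  exact: (rpredB (H 1%G) (H Q)).
have -> : ('Fix_(rcosets P [set: S] | 'Rs)(1) = rcosets P [set: S])%g.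
  by apply/setIidPl/subsetP=> C _; apply/afixP=> a /set1P->; apply: act1.
rewrite mark1_bcls pmulrn mulrzz -PoszM; congr Posz; apply/eqP.
rewrite -(eqn_pmul2r (cardG_gt0 P)) card_twist mulnAC -/(indexg _ _).
by rewrite mulnC [X in (_ * X)%N]mulnC Lagrange ?subsetT // cardsT.
Qed.

(** Marks at the twisted diagonals of order [k] may be prescribed up to the
    indices [|N(D) : D|]: the orbit with stabilizer [D] has mark [|N(D) : D|] at
    the conjugates of [D] and [0] at the other groups of order [k].  The
    induction is on the number of wrong marks; one orbit repairs a whole
    conjugacy class. *)
Lemma adjust_marks k (t : {group S * S} -> int) (x : A) :
  (forall D E a, fdiag F D -> E = (D :^ a)%g :> {set _} -> t E = t D) ->
  (forall D, fdiag F D -> #|D| = k ->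
     exists m : int, (t D - mark D x) *+ #|D| = m *+ #|'N(D)%g|) ->
  exists2 w, w \in pair_span (eq k) &
    forall D, fdiag F D -> #|D| = k -> mark D (x + w.1) = t D.
Proof.
move=> tJ; pose bad x := [set D : {group S * S} |
  [&& `[< fdiag F D >], #|D| == k & mark D x != t D]].
have [n] := ubnP #|bad x|; elim: n x => // n IHn x ltn tx.
have [b0|[D]] := set_0Vmem (bad x).
  exists 0 => [|D fD kD]; first exact: rpred0.
  rewrite addr0; apply/eqP; move/setP/(_ D): b0; rewrite !inE kD eqxx /=.
  by move/asboolP: fD => -> /= /negbFE.
rewrite inE => /and3P[/asboolP fD /eqP kD neD].
have [m em] := tx D fD kD; have [f [phi Fphi ephi] eD] := fD.
pose u : A * A := (bcls (biset_twist phi), bcls (biset_twist (idm_morphism (fst_group D)))).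
have eDphi : D = graph phi :> {set _}.
  by rewrite eD; apply: eq_in_imset => r Dr; rewrite ephi.
have kP : k = #|fst_group D| by rewrite -kD eDphi card_graph.
have uK : u \in pair_span (eq k) by apply: mem_zspan; exists (fst_group D), phi.
have eM : t D - mark D x = mark D u.1 *~ m.
  have eN : mark D u.1 *+ #|D| = #|'N(D)%g|%:Z.
    by rewrite eDphi card_graph mark_twist_graph.
  apply: (Num.Theory.pmulrnI (cardG_gt0 D)).
  by rewrite em [LHS]pmulrn !mulrzz -eN mulrnAr mulrC.
have markD1 (E : {group S * S}) : mark E (x + (u *~ m).1) = mark E x + mark E u.1 *~ m.
  by rewrite markD (raddfMz fst) markMz.
have markE (E : {group S * S}) : fdiag F E -> #|E| = k ->
    mark E (x + (u *~ m).1) = t E \/ mark E (x + (u *~ m).1) = mark E x.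
  move=> fE kE; rewrite markD1.
  have [->|/mark_twist_neq0[a sEa]] := eqVneq (mark E u.1) 0.
    by right; rewrite mul0rz addr0.
  have eE : E = (D :^ a)%g :> {set _}.
    by apply/eqP; rewrite eqEcard cardJg kE kD leqnn eDphi sEa.
  by left; rewrite eE !markJ (tJ _ _ _ fD eE) -eM addrC subrK.
have [||w wK ew] := IHn (x + (u *~ m).1).
- rewrite -ltnS; apply: leq_trans ltn; rewrite ltnS; apply: proper_card.
  apply/properP; split.
    apply/subsetP=> E; rewrite !inE => /and3P[fE kE]; rewrite fE kE /=.
    by have [->|->] := markE E (asboolW fE) (eqP kE); rewrite ?eqxx.
  exists D; rewrite !inE ?(asboolT fD) ?kD ?eqxx ?neD //= negbK.
  by rewrite markD1 -eM addrC subrK.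
- move=> E fE kE; have [->|->] := markE E fE kE; last exact: tx.
  by exists 0; rewrite subrr !mul0rn.
exists (u *~ m + w) => [|E fE kE]; first by rewrite rpredD ?rpredMz.
by rewrite -(ew E fE kE) -addrA.
Qed.

Definition stable_above k (x : A) := forall D E, (k < #|D|)%N -> tconj F D E ->
  mark E x = mark D x.

(** A normalizer [K] of [D1] moved into the normalizer of [D0] acts on the
    fixed points of both.  In the two Cauchy-Frobenius sums all terms agree,
    by stability on larger groups, except those of the elements of [D1]. *)
Lemma mark_congr_tconj (x : A) D0 D1 f h :
  stable_above #|D1| x -> fhom F (fst_group 'N(D1)%g) f -> D0 = twisted_image f h D1 :> {set _} ->
  exists m : int, (mark D0 x - mark D1 x) *+ #|D1| = m *+ #|'N(D1)%g|.
Proof.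
move=> stx Ff eD0; pose K := [group of 'N(D1)%g]; pose ka := twisted_image_morphism h Ff.
have sD1K : D1 \subset K by apply: normG.
have eD0k : D0 = (ka @* D1)%g :> {set _} by rewrite eD0 morphimEsub.
have [m1 e1] := mark_congr x (subxx K : K \subset 'N(D1)%g).
have nK' : (ka @* K)%G \subset 'N(D0)%g by rewrite eD0k; apply: morphim_norms.
have kI := injm_twisted_image h Ff.
have [m0 e0] : exists m0 : int, \sum_(a in K) mark (ka a |: D0) x = m0 *+ #|K|.
  have [m0 em0] := mark_congr x nK'; exists m0.
  rewrite -(card_injm kI (subxx K)) -em0 /= morphimEdom big_imset //= => u v Nu Nv.
  exact: (twisted_image_inj Ff Nu Nv).
exists (m0 - m1); rewrite [RHS]mulrnBl -[X in _ = X - _]e0 -[X in _ = _ - X]e1 -sumrB.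
rewrite (bigID (mem D1)) /=.
(* outside [D1] the terms cancel, by stability at the group generated by [a |: D1] *)
rewrite [X in _ = _ + X]big1 ?addr0 => [|a /andP[Ka nDa]]; last first.
  pose E := <<a |: D1>>%G.
  have sEK : E \subset K by rewrite gen_subG subUset sub1set Ka.
  have fE : fhom F (fst_group E) f by apply: (fhom_sub _ Ff); apply: morphimS.
  have eE : (ka @* E)%G = twisted_image f h E :> {set _}.
    by rewrite /= [RHS](twisted_imageE h fE) !morphimEsub.
  apply/eqP; rewrite subr_eq0 -[X in _ == X]mark_gen -mark_gen; apply/eqP.
  have -> : <<ka a |: D0>>%g = (ka @* E)%G.
    rewrite /= morphim_gen ?subUset ?sub1set ?Ka //.
    by rewrite morphimU morphim_set1 // eD0k.
  apply: (stx E); last by exists f, h.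
  apply: proper_card; apply/properP; split; first by rewrite sub_gen // subsetUr.
  by exists a => //; rewrite mem_gen // setU11.
rewrite (eq_bigl (mem D1)) => [|a]; last first.
  by rewrite /= andbC; case: (boolP (a \in D1)) => // /(subsetP sD1K).
rewrite (eq_bigr (fun _ => mark D0 x - mark D1 x)) ?sumr_const // => a D1a.
have D0a : ka a \in D0 by rewrite eD0k mem_morphim ?(subsetP sD1K).
by rewrite (setUidPr _) ?sub1set // (setUidPr _) ?sub1set.
Qed.

(** As [pick] is extensional, this reference only depends on the class. *)
Definition class_ref D := odflt D [pick E : {group S * S} | `[< tconj F D E /\ receptive F E >]].

Lemma class_refP D : fdiag F D -> tconj F (class_ref D) D /\ receptive F (class_ref D).
Proof.
move=> /(ex_receptive pS satF)[E tDE gE]; rewrite /class_ref.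
case: pickP => [E' /asboolP[t g]|/(_ E)/asboolP[]] //=.
by split=> //; apply: tconj_sym.
Qed.

Lemma class_ref_tconj D E : fdiag F D -> tconj F D E -> class_ref D = class_ref E.
Proof.
move=> fD tDE; rewrite /class_ref.
have /eq_pick-> : (fun E' => `[< tconj F E E' /\ receptive F E' >]) =1
                  (fun E' => `[< tconj F D E' /\ receptive F E' >]).
  move=> E'; apply/asboolP/asboolP=> -[t g]; split=> //.
    exact: tconj_trans tDE t.
  by apply: tconj_trans t; apply: tconj_sym.
case: pickP => [E' _|none] //=; have [E' t g] := ex_receptive pS satF fD.
by have /asboolP[] := none E'.
Qed.

(** The target mark at [D] is the mark at the reference of its class, which is
    within reach by [mark_congr_tconj].  Larger groups have no fixed points in
    the added orbits. *)
Lemma stabilize k (x : A) :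
  (forall D, ~ fdiag F D -> mark D x = 0) -> stable_above k.+1 x ->
  exists2 w, w \in pair_span (eq k.+1) & stable_above k (x + w.1).
Proof.
move=> offx stx; pose t D := mark (class_ref D) x.
have [||w wK ew] := @adjust_marks k.+1 t x.
- by move=> D E a fD eE; rewrite /t (class_ref_tconj fD (tconj_conj F eE)).
- move=> D fD kD; have [tr gr] := class_refP fD.
  have [f [h [Ff e]]] := gr _ tr.
  by apply: (mark_congr_tconj _ Ff e); rewrite kD.
exists w => // D E kD tDE; have cE := card_tconj tDE.
move: kD; rewrite leq_eqVlt => /predU1P[kD|kD]; last first.
  by rewrite !markD !(mark_span_gt wK) ?cE // (stx D E).
have [/asboolP fD|/asboolP nD] := boolP `[< fdiag F D >].
  rewrite !ew ?cE //; last exact: fdiag_tconj tDE fD.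
  by rewrite /t (class_ref_tconj fD tDE).
have nE : ~ fdiag F E by move/(fdiag_tconj (tconj_sym tDE)).
by rewrite !markD !offx // !(mark_span_fdiag wK).
Qed.

Lemma card_fdiag D : fdiag F D -> #|D| = #|fst_group D|.
Proof. by case=> f _ {1}->; apply: card_imset => r s []. Qed.

Lemma fdiag_top D : fdiag F D -> #|D| = #|S| -> fst_group D = [set: S]%G.
Proof.
move=> fD kD; apply/val_inj/eqP; rewrite eqEcard subsetT cardsT -kD.
by rewrite (card_fdiag fD) leqnn.
Qed.

Local Notation C := 'C([set: S])%g.

(** The normalizer of the graph [D] of an automorphism of [S] is the product of
    [D] and of the center of [S] in the right factor. *)
Lemma norm_fdiag_top D : fdiag F D -> #|D| = #|S| -> (#|'N(D)%g| %| #|D| * #|C|)%N.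
Proof.
move=> fD kD; have eP := fdiag_top fD kD; have [f Ff eD] := fD.
rewrite eP in eD Ff; have fM := fhomM Ff.
have fS y : exists r, y = f r.
  have : f @: [set: S] = setT.
    apply/eqP; rewrite eqEcard subsetT card_in_imset ?leqnn //.
    exact: fhom_inj Ff.
  by move/setP/(_ y); rewrite inE => /imsetP[r _ ->]; exists r.
have fJ r s : f (r ^ s)%g = (f r ^ f s)%g.
  apply: (mulgI (f s)); rewrite -fM ?inE // conjgE !mulgA mulgV mul1g.
  by rewrite fM ?inE // mulgV mul1g.
pose H := setX_group (1%G : {group S}) [group of C].
have Cfix c s : c \in C -> (s ^ c)%g = s.
  by move=> /centP Cc; apply/conjg_fixP/commgP; apply/esym/Cc; rewrite inE.
have eN : 'N(D)%g = (D * H)%g :> {set _}.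
  apply/setP=> -[x y]; apply/idP/mulsgP=> [/normP Nxy|[d [a c] Dd]].
    exists (x, f x) (1%g, ((f x)^-1 * y)%g).
    - by rewrite eD; apply/imsetP; exists x; rewrite ?inE.
    - rewrite in_setX set11 /=; apply/centP=> s _; apply/esym/commgP/conjg_fixP.
      have [r er] := fS (s ^ (f x)^-1)%g.
      have : ((r, f r) ^ (x, y))%g \in D.
        by rewrite -Nxy memJ_conjg eD; apply/imsetP; exists r; rewrite ?inE.
      rewrite eD => /imsetP[r' _ [e1 e2]].
      by rewrite conjgM er [LHS]e2 -e1 [LHS]fJ -er conjgKV.
    by congr (_, _); rewrite ?mulg1 ?mulKVg.
  rewrite in_setX => /andP[/set1P-> Cc] ->.
  rewrite groupM ?(subsetP (normG D) d) // inE; apply/subsetP=> _ /imsetP[[r s] Drs ->].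
  rewrite (_ : (r, s) ^ (1, c) = (r, s))%g //.
  by congr (_, _); [apply: conjg1 | apply: Cfix].
have := mul_cardG D H; rewrite -eN => e.
have <- : #|H| = #|C| by rewrite cardsX cards1 mul1n.
by apply/dvdnP; exists #|D :&: H|; rewrite e mulnC.
Qed.

Lemma card_fdiag_top :
  #|[set D : {group S * S} | `[< fdiag F D >] && (#|D| == #|S|)]| =
  #|Aut_fus F [set: S]%G|.
Proof.
pose gr (a : {perm S}) : {set S * S} := [set (r, a r) | r in [set: S]].
have grI : injective gr.
  move=> a b e; apply/permP=> r.
  have : (r, a r) \in gr b by rewrite -e imset_f ?inE.
  by case/imsetP=> _ _ [<-].
rewrite -(card_imset _ (@group_inj (S * S)%type)) -(card_imset _ grI).
apply: eq_card => B; apply/imsetP/imsetP=> [[D]|[a]].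
  rewrite inE => /andP[/asboolP fD /eqP kD] ->.
  have eP := fdiag_top fD kD; have [f] := fD; rewrite eP => Ff eD.
  have [phi Fphi ephi] := Ff.
  have fI : injective f by move=> x y; apply: (fhom_inj Ff); rewrite inE.
  exists (perm fI); last first.
    by rewrite eD; apply: eq_in_imset => r _; rewrite permE.
  rewrite inE; apply/andP; split.
    rewrite inE; apply/andP; split.
      by apply/subsetP=> x _; rewrite inE.
    by apply/morphicP=> x y _ _; rewrite !permE; apply: (fhomM Ff); rewrite inE.
  by apply/asboolP; exists phi => // x Px; rewrite ephi ?permE.
rewrite inE => /andP[_ /asboolP[phi Fphi ephi]] ->.
exists (graph_group phi); last by apply: eq_in_imset => r Pr; rewrite ephi.
rewrite inE /= card_graph cardsT eqxx andbT; apply/asboolP; exact: fdiag_graph.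
Qed.

(** [S] is fully normalized, so [Aut_S(S)], which is [S] modulo its center, is
    a Sylow subgroup of [Aut_F(S)]. *)
Lemma AutS_index : exists2 j, ~~ (p %| j)%N &
  (#|Aut_fus F [set: S]%G| * #|C| = #|S| * j)%N.
Proof.
have NT : 'N([set: S])%g = [set: S].
  by apply/setP=> x; rewrite !inE; apply/subsetP=> y _; rewrite inE.
have fnS : fully_normalized F [set: S]%G.
  by move=> P _; rewrite NT subset_leq_card ?subsetT.
have [_ sylS] := satF.1 _ fnS.
exists #|Aut_fus F [set: S]%G : Aut_S [set: S]%G|%g.
  by rewrite -p'natE // ; case/and3P: sylS.
rewrite -(Lagrange (pHall_sub sylS)) mulnAC; congr (_ * _)%N.
rewrite card_morphim setIid ker_conj_aut mulnC.
have -> : #|S| = #|'N([set: S])%g| by rewrite NT cardsT.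
by rewrite Lagrange ?cent_sub.
Qed.

(** Prescribing the mark [|Z(S)|] at every graph of order [|S|] amounts to
    adding one orbit for each class in [Out_F(S)]; the number of points is then
    [|Aut_F(S)| |Z(S)|], which is [|S|] times the index [|Out_F(S)|]. *)
Lemma stabilize_top : exists2 w, w \in pair_span (eq #|S|) &
  stable_above #|S|.-1 w.1 /\ exists2 j, ~~ (p %| j)%N & mark 1%g w.1 = j%:Z *+ #|S|.
Proof.
have [||w wK ew] := @adjust_marks #|S| (fun _ => #|C|%:Z) 0 => //.
  move=> D fD kD; have /dvdnP[j ej] := norm_fdiag_top fD kD.
  exists j%:Z; rewrite mark0 subr0 !pmulrn !mulrzz -!PoszM.
  by rewrite mulnC ej.
have {}ew D : fdiag F D -> #|D| = #|S| -> mark D w.1 = #|C|%:Z.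
  by move=> fD kD; rewrite -(ew D fD kD) add0r.
exists w => //; split.
  have S_gt0 : (0 < #|S|)%N by rewrite -cardsT (cardG_gt0 [set: S]%G).
  move=> D E; rewrite prednK // => kD tDE.
  have [/asboolP fD|/asboolP nD] := boolP `[< fdiag F D >].
    have {}kD : #|D| = #|S|.
      by apply/eqP; rewrite eqn_leq kD (card_fdiag fD) max_card.
    by rewrite !ew ?(card_tconj tDE) //; apply: fdiag_tconj tDE fD.
  have nE : ~ fdiag F E by move/(fdiag_tconj (tconj_sym tDE)).
  by rewrite !(mark_span_fdiag wK).
have [j pj ej] := AutS_index; exists j => //.
rewrite degree_span_top // (eq_bigr (fun _ => #|C|%:Z)) => [|D /andP[/asboolP fD /eqP kD]].
  rewrite sumr_const; move: ej; rewrite -card_fdiag_top cardsE => ej.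
  by rewrite !pmulrn !mulrzz -!PoszM mulnC ej mulnC.
exact: ew.
Qed.

(** Descend from the groups of order [|S|]; below it the degree only changes by
    multiples of [p]. *)
Lemma ex_characteristic : exists2 v, v \in pair_span (fun _ => True) &
  (forall D E, tconj F D E -> mark E v.1 = mark D v.1) /\
  exists2 j : int, ~~ (p%:Z %| j)%Z & mark 1%g v.1 = j *+ #|S|.
Proof.
have H k : (k < #|S|)%N -> exists2 v, v \in pair_span (fun _ => True) &
    stable_above (#|S|.-1 - k) v.1 /\
    exists2 j : int, ~~ (p%:Z %| j)%Z & mark 1%g v.1 = j *+ #|S|.
  elim: k => [_|k IHk kS].
    have [w wK [stw [j pj ej]]] := stabilize_top.
    exists w; first exact: span_sub wK.
    by rewrite subn0; split=> //; exists j%:Z.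
  have [v vK [stv [j pj ej]]] := IHk (ltnW kS).
  have ek : (#|S|.-1 - k = (#|S|.-1 - k.+1).+1)%N.
    by rewrite -subSn ?subSS // -ltnS prednK // (leq_trans _ kS).
  rewrite ek in stv.
  have [w wK stw] := stabilize (fun D => mark_span_fdiag vK) stv.
  exists (v + w); first by rewrite rpredD // (span_sub _ wK).
  split=> //; have [|m em] := degree_span_lt wK.
    by rewrite -ek -[X in (_ < X)%N]prednK ?(leq_trans _ kS) // ltnS leq_subr.
  exists (j + m *+ p); last by rewrite markD ej em mulrnDl mulrnA.
  by rewrite rpredDr // pmulrn mulrzz dvdz_mull.
have S_gt0 : (0 < #|S|)%N by rewrite -cardsT (cardG_gt0 [set: S]%G).
have [|v vK [stv degv]] := H #|S|.-1; first by rewrite prednK.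
by exists v => //; split=> // D E tDE; apply: stv; rewrite // subnn.
Qed.

End CharacteristicElement.

(** * Action on stable elements *)

Section FunctorAdditive.
Variables (K : preadd_cat) (M : cofunctor K) (x y : K).
Implicit Types f g : Defs.hom x y.

Lemma fmap0 a : fmap M (0 : Defs.hom x y) a = 0.
Proof. by apply: (addrI (fmap M 0 a)); rewrite -fmapD !addr0. Qed.
Lemma fmapN f a : fmap M (- f) a = - fmap M f a.
Proof. by apply: (addrI (fmap M f a)); rewrite -fmapD !subrr fmap0. Qed.
Lemma fmapB f g a : fmap M (f - g) a = fmap M f a - fmap M g a.
Proof. by rewrite fmapD fmapN. Qed.
Lemma fmapMz f a (m : int) : fmap M (f *~ m) a = fmap M f a *~ m.
Proof.
have Mn (n : nat) : fmap M (f *+ n) a = fmap M f a *+ n.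
  by elim: n => [|n IHn]; rewrite ?mulr0n ?fmap0 // !mulrS fmapD IHn.
by case: m => n; rewrite ?NegzE ?mulrNz ?fmapN -!pmulrn Mn.
Qed.

End FunctorAdditive.

Section StableElements.
Variables (p : nat) (S : finGroupType) (F : fusion_system S).
Hypotheses (p_pr : prime p) (pS : (p.-group [set: S])%g) (satF : saturated F p).
Variables (C : collection) (CS : C S).
Local Notation K := (@full_subcat bifree_cat C).
Local Notation r := (mackey_restrictions CS).
Local Notation top := (res_top r).
Local Notation End := (Defs.hom top top).

Local Notation spanT := (pair_span F (fun _ => True)).

Definition transfer (P : {group S}) : Defs.hom top (res_sub r P) :=
  Subz (bifree_bcls (bifree_transfer P)).

Lemma val_transfer_res (P : {group S}) (phi : {morphism P >-> S}) (inj : ('injm phi)%g) :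
  val (comp_hom (res_hom r inj) (transfer P) : End) = bcls (biset_twist phi).
Proof.
rewrite /= bcompE; congr groth_in; apply/bclassP; exact: transfer_res_iso.
Qed.

(** [[P, phi]_S^S] acts as [res_phi] followed by transfer, and [res_phi] is
    [res_P] on stable elements.  The existential form lets the induction build
    the endomorphisms lying over [v.1] and [v.2]. *)
Lemma span_stable (M : cofunctor K) (v : burnside S S * burnside S S) (X : M top) :
  X \in Defs.stable F r M -> v \in spanT ->
  exists a b : End, [/\ val a = v.1, val b = v.2 & fmap M a X = fmap M b X].
Proof.
move=> /asboolP stX; move: v; apply: zspan_ind.
- by exists 0, 0.
- move=> u v [a [b [ea eb eab]]] [a' [b' [ea' eb' eab']]].
  exists (a - a'), (b - b'); split; rewrite ?fmapB ?eab ?eab' //=.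
    by rewrite -ea -ea'.
  by rewrite -eb -eb'.
move=> _ [P [phi [_ Fphi ->]]].
exists (comp_hom (res_hom r (fus_injm Fphi)) (transfer P)).
exists (comp_hom (res_hom r (injm_idm P)) (transfer P)).
split; try exact: val_transfer_res.
by rewrite !fmap_comp; congr (fmap M _ _); apply: stX.
Qed.

Lemma mark_res (P : {group S}) (phi : {morphism P >-> S}) (x : burnside S S)
    (E : {set subg_of P * S}) :
  mark E (bcomp x (bcls (biset_twist (on_subg_morphism phi)))) =
  mark [set (phi (sgval e.1), e.2) | e in E] x.
Proof.
elim/burnside_ind: x => [X|x y Hx Hy]; last by rewrite bcompBl !markB Hx Hy.
by rewrite bcompE !mark_bcls card_fixpts_res.
Qed.

Lemma group_set_res (P : {group S}) (phi : {morphism P >-> S})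
    (E : {group subg_of P * S}) :
  group_set [set (phi (sgval e.1), e.2) | e in E].
Proof.
apply/group_setP; split.
  by apply/imsetP; exists 1%g; rewrite ?group1 //= morph1.
move=> _ _ /imsetP[a Ea ->] /imsetP[b Eb ->]; apply/imsetP.
by exists (a * b)%g; rewrite ?groupM //= morphM ?subgP.
Qed.

(** Restricting [x] along [phi] moves [E <= P * S] by [phi] on the left, so the
    two restrictions of [x] have the same marks. *)
Lemma bcomp_res_eq (x : burnside S S) (P : {group S}) (phi : {morphism P >-> S}) :
  (forall D E, tconj F D E -> mark E x = mark D x) -> F P [set: S]%G phi ->
  bcomp x (bcls (biset_twist (on_subg_morphism phi))) =
  bcomp x (bcls (biset_twist (on_subg_morphism (idm_morphism P)))).
Proof.
move=> stx Fphi; apply: mark_inj => E.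
apply: (etrans (mark_res phi x E)); apply: (etrans _ (esym (mark_res (idm_morphism P) x E))).
apply: (stx (Group (group_set_res (idm_morphism P) E)) (Group (group_set_res phi E))).
exists phi, 1%g; split.
  apply: (fhom_sub _ (fus_fhom Fphi)).
  by apply/subsetP=> y /fst_groupP[z /imsetP[e _ [-> _]]]; apply: subgP.
by rewrite /twisted_image /= -imset_comp; apply: eq_imset => e /=; rewrite conjg1.
Qed.

Lemma fmap_stable (M : cofunctor K) (a : End) (X : M top) :
  (forall D E, tconj F D E -> mark E (val a) = mark D (val a)) ->
  fmap M a X \in Defs.stable F r M.
Proof.
move=> sta; apply/asboolP=> P phi Fphi; rewrite /res -!fmap_comp.
congr (fmap M _ X); apply: val_inj; exact: (bcomp_res_eq sta Fphi).
Qed.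

Section Annihilation.
Variables (u1 u2 : End).

(** [x |-> x o (u2 - n)], contravariantly turned into [M(u2) - n]. *)
Definition shift (n : int) (y : End) : End := comp_hom y u2 - y *~ n.

(** Induction on [ns]: the value found so far is stable, so that [M(u2)] acts on
    it as [M(u1)]. *)
Lemma shift_stable (M : cofunctor K) (X : M top) (ns : seq int) :
  (forall Y, fmap M u1 Y \in Defs.stable F r M) ->
  (forall Y, Y \in Defs.stable F r M -> fmap M u1 Y = fmap M u2 Y) ->
  X \in Defs.stable F r M ->
  exists w, fmap M (foldr shift (id_hom top) ns) X =
            X *~ (\prod_(n <- ns) - n) + fmap M u1 w.
Proof.
move=> stu eu stX; elim: ns => [|n ns [w IHw]] /=.
  by exists 0; rewrite raddf0 addr0 big_nil fmap_id.
rewrite big_cons; set c := \prod_(_ <- _) _ in IHw *.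
exists (X *~ c + fmap M u1 w - w *~ n).
rewrite /shift fmapB fmap_comp fmapMz IHw -eu; last first.
  by rewrite rpredD ?rpredMz.
rewrite [fmap M u1 (_ - _)]raddfB (raddfMz (fmap M u1)) mulrzDl opprD.
by rewrite mulNr mulrNz -mulrzA (mulrC n) addrCA.
Qed.

End Annihilation.

Lemma mark_shift (v : burnside S S * burnside S S) (n : {set S} -> int) (u2 : End)
    (E : {group S * S}) (ns : seq int) :
  (forall x (B : {set S * S}), mark B (bcomp x v.2) = n [set e.1 | e in B] * mark B x) ->
  val u2 = v.2 ->
  mark E (val (foldr (shift u2) (id_hom top) ns)) =
  (\prod_(m <- ns) (n [set e.1 | e in E] - m)) * mark E (val (id_hom top : End)).
Proof.
move=> nE eu2; elim: ns => [|m ns IHns]; first by rewrite big_nil mul1r.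
rewrite big_cons [foldr _ _ _]/=; set y := foldr _ _ _ in IHns *.
rewrite -mulrA -IHns mulrBl -nE -eu2 /shift.
rewrite -[val _]/(val (comp_hom y u2 : End) - val (y *~ m)) markB.
rewrite (raddfMz val) markMz mulrzz mulrC //.
Qed.

(** Each mark is annihilated by one factor of the product of the [M(u2) - n(Q)]
    over [Q <= S], so the product is zero, and [shift_stable] writes [c X] as
    [M(u1) w'].  No [n(Q)] is divisible by [p], being congruent to the degree
    [j]. *)
Lemma ex_stable_preimage (M N : cofunctor K) (b : nat_trans M N) (X : N top) :
  (forall Z : N top, exists Y, b top Y = Z) -> X \in Defs.stable F r N ->
  exists2 c : nat, coprime p c &
    exists2 Y : M top, Y \in Defs.stable F r M & b top Y = X *+ c.
Proof.
move=> surj stX.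
have [v vK [stv [j pj ej]]] := ex_characteristic p_pr pS satF.
have [n [nE np n1]] := span_multipliers pS vK.
have [u1 [u2 [eu1 eu2 _]]] := span_stable (rpred0 (Defs.stable F r N)) vK.
have stu (L : cofunctor K) (Y : L top) : fmap L u1 Y \in Defs.stable F r L.
  by apply: fmap_stable; rewrite eu1.
have eu Y : Y \in Defs.stable F r N -> fmap N u1 Y = fmap N u2 Y.
  move=> stY; have [a [a' [ea ea' e]]] := span_stable stY vK.
  have -> : u1 = a by apply: val_inj; rewrite eu1 ea.
  by have -> : u2 = a' by apply: val_inj; rewrite eu2 ea'.
pose ns := [seq n (gval Q) | Q <- enum {group S}].
have y0 : foldr (shift u2) (id_hom top) ns = 0.
  apply: val_inj; apply: mark_inj => E; rewrite (mark_shift _ _ nE eu2).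
  rewrite mark0; apply/eqP; rewrite mulf_eq0 prodf_seq_eq0; apply/orP; left.
  apply/hasP; exists (n (fst_group E)).
    by apply: map_f; rewrite mem_enum.
  rewrite /= subr_eq0; apply/eqP; congr n.
  by rewrite /= morphimEsub ?subsetT.
have [w] := shift_stable ns (@stu N) eu stX.
rewrite y0 fmap0; set c := \prod_(_ <- _) _ => ew.
have pc : ~~ (p %| `|c|)%N.
  rewrite /c; have : all (fun m => ~~ (p%:Z %| m)%Z) ns.
    apply/allP=> _ /mapP[Q _ ->]; apply: contra pj => pn.
    have -> : j = n 1%g.
      apply: (@Num.Theory.pmulrnI _ #|S|); last by rewrite n1 ej.
      by rewrite -cardsT (cardG_gt0 [set: S]%G).
    by have := rpredB pn (np Q); rewrite subKr.
  elim: (ns) => [_|m l IHl /andP[pm /IHl pl]]; first by rewrite big_nil /= dvdn1 gtn_eqF ?prime_gt1.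
  by rewrite big_cons abszM Euclid_dvdM // negb_or abszN pm.
have [w' ew'] : exists w', fmap N u1 w' = X *+ `|c|.
  case: (c) ew => m /eqP.
    by rewrite eq_sym addr_eq0 => /eqP e; exists (- w); rewrite raddfN -e -pmulrn.
  by rewrite NegzE mulrNz eq_sym addrC subr_eq0 => /eqP e; exists w; rewrite e abszN -pmulrn.
have [Y0 eY0] := surj w'.
exists `|c|%N; first by rewrite prime_coprime.
exists (fmap M u1 Y0); first exact: stu.
by rewrite ntnat eY0.
Qed.

End StableElements.

(** * Localization and biset functors *)

Section LocalizedExactness.
Variables (p : nat) (S : finGroupType) (F : fusion_system S).
Variables (K : preadd_cat) (r : restrictions K S).
Variables (M1 M2 M3 : cofunctor K) (a : nat_trans M1 M2) (b : nat_trans M2 M3).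
Local Notation top := (res_top r).

(** The hypothesis on [b] is surjectivity up to a denominator.  In the middle, a
    preimage of a stable element is stable because [a] is injective at every
    [P], and not only at [S]. *)
Lemma short_exact_loc_stable : short_exact_seq a b ->
  (forall X : M3 top, X \in Defs.stable F r M3 -> exists2 c : nat, coprime p c &
    exists2 Y : M2 top, Y \in Defs.stable F r M2 & b top Y = X *+ c) ->
  short_exact (loc_map p (stable_map F r a)) (loc_map p (stable_map F r b)).
Proof.
move=> ab lift; have [injA exA _] := ab top.
have valMn (L : cofunctor K) (x : stable_group F r L) n : val (x *+ n) = val x *+ n.
  exact: (raddfMn val).
split.
- elim/locW=> x m; elim/locW=> y n; rewrite /= !loc_mapE => /fracP[k e].
  apply/fracP; exists k; apply: val_inj; apply: injA.
  by have := congr1 val e; rewrite !valMn /= !raddfMn.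
- elim/locW=> y n; split=> [|[]].
    rewrite /= loc_mapE => /(fracP _ _ (0 : stable_group F r M3) (denom1 p))[k e].
    have := congr1 val e; rewrite muln1 !mul0rn valMn /= -raddfMn => /exA[x ex].
    have stx : x \in Defs.stable F r M1.
      apply/asboolP=> P phi Fphi; have [injP _ _] := ab (res_sub r P).
      apply: injP; rewrite !ntnat ex !raddfMn; congr (_ *+ _).
      by have /asboolP := valP y; apply.
    exists (Defs.frac (Subz stx : stable_group F r M1) (denomM n k)).
    rewrite /= loc_mapE; apply/fracP; exists (denom1 p); apply: val_inj.
    by rewrite !valMn /= ex -!mulrnA !mul1n mulnC.
  elim/locW=> x m; rewrite /= !loc_mapE => /fracP[k e].
  apply/(fracP _ _ (0 : stable_group F r M3) (denom1 p)).
  exists (denomM k m); apply: val_inj; rewrite mul0rn valMn /= muln1.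
  have := congr1 val e; rewrite !valMn /= => e'.
  by rewrite -raddfMn -e' -raddfMn; apply/exA; exists (val x *+ (val k * val n)).
elim/locW=> z n; have [c pc [Y stY eY]] := lift _ (valP z).
pose cd : denom p := exist (fun k => coprime p k) c pc.
exists (Defs.frac (Subz stY : stable_group F r M2) (denomM cd n)).
rewrite /= loc_mapE; apply/fracP; exists (denom1 p); apply: val_inj.
by rewrite !valMn /= eY -!mulrnA !mul1n.
Qed.

End LocalizedExactness.

(** Restrictions and transfers are given by bifree bisets, so biset functors
    are treated through their underlying Mackey functors. *)
Section Underlying.
Variable C : collection.

Definition mackey_of (M : biset_functor C) : global_mackey_functor C.
Proof.
pose B := @full_subcat burnside_cat C.
unshelve refine (@Cofunctor (@full_subcat bifree_cat C) (fun x => fob M (x : B))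
  (fun x y f => @fmap B M x y (val f)) _ _ _).
- by move=> x y f g a; apply: (@fmapD B M).
- by move=> x a; apply: (@fmap_id B M).
by move=> x y z g f a; apply: (@fmap_comp B M).
Defined.

Definition mackey_of_trans (M N : biset_functor C) (a : nat_trans M N) :
  nat_trans (mackey_of M) (mackey_of N).
Proof.
pose B := @full_subcat burnside_cat C.
unshelve refine (@NatTrans _ (mackey_of M) (mackey_of N) (fun x => @ntapp B M N a (x : B)) _).
by move=> x y f u; apply: (@ntnat B M N a).
Defined.

End Underlying.

Unset Implicit Arguments.

Theorem proposition2p6 (p : nat) (S : finGroupType) (F : fusion_system S) :
  prime p -> (p.-group [set: S])%g -> saturated F p ->
  forall (C : collection) (CS : C S),
    (forall (M1 M2 M3 : biset_functor C)
            (a : nat_trans M1 M2) (b : nat_trans M2 M3),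
       short_exact_seq a b ->
       short_exact (loc_map p (stable_map F (biset_restrictions CS) a))
                   (loc_map p (stable_map F (biset_restrictions CS) b)))
    /\
    (forall (M1 M2 M3 : global_mackey_functor C)
            (a : nat_trans M1 M2) (b : nat_trans M2 M3),
       short_exact_seq a b ->
       short_exact (loc_map p (stable_map F (mackey_restrictions CS) a))
                   (loc_map p (stable_map F (mackey_restrictions CS) b))).
Proof.
move=> p_pr pS satF C CS; split=> M1 M2 M3 a b ab; apply: short_exact_loc_stable => // X stX.
  have [_ _ surj] := ab (res_top (biset_restrictions CS)).
  exact: (ex_stable_preimage p_pr pS satF (b := mackey_of_trans b) (X := X) surj stX).
have [_ _ surj] := ab (res_top (mackey_restrictions CS)).
exact: (ex_stable_preimage p_pr pS satF surj stX).
Qed.
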